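(* Let $1\le p\le 2$ and $\phi\in\mathcal{L}^p(\mathbb{R})\cap BV_0(\mathbb{R})\cap AC_{loc}(\mathbb{R})$. Then: (i) $\mathcal{F}_{HK}(\phi)\in C_\infty(\mathbb{R}\setminus\{0\})$; (ii) $\mathcal{F}_{HK}(\phi)(s)=\mathcal{F}_p(\phi)(s)$ for almost every $s\in\mathbb{R}$; (iii) $\phi'\in\mathcal{L}^1(\mathbb{R})$ and for every $s\in\mathbb{R}\setminus\{0\}$, $$\mathcal{F}_{HK}(\phi)(s)=-\frac{i}{s}\,\mathcal{F}_1(\phi')(s);$$ (iv) for every $s\neq 0$, $\displaystyle |\mathcal{F}_{HK}(\phi)(s)|\le \frac{1}{\sqrt{2\pi}}\cdot\frac{1}{|s|}\,\|\phi'\|_1$.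
   Context: $BV_0(\mathbb{R})$: real functions of bounded variation on $\mathbb{R}$ vanishing at $\pm\infty$. $AC_{loc}(\mathbb{R})$: functions absolutely continuous on each compact interval. $C_\infty(\mathbb{R}\setminus\{0\})$: complex-valued continuous functions on $\mathbb{R}\setminus\{0\}$ vanishing at $\pm\infty$. For $f\in\mathcal{L}^1(\mathbb{R})$, $\mathcal{F}_1(f)(s)=\frac{1}{\sqrt{2\pi}}\int_{\mathbb{R}}e^{-isx}f(x)\,dx$ (Lebesgue integral). $\mathcal{F}_2$ is the Plancherel extension of $\mathcal{F}_1$ from $\mathcal{L}^1\cap\mathcal{L}^2$ to $\mathcal{L}^2(\mathbb{R})$. For $1<p<2$, $\mathcal{F}_p:\mathcal{L}^p(\mathbb{R})\to\mathcal{L}^q(\mathbb{R})$ ($p^{-1}+q^{-1}=1$) is $\mathcal{F}_p(f)=\mathcal{F}_1(f_1)+\mathcal{F}_2(f_2)$ where $f=f_1+f_2$, $f_1\in\mathcal{L}^1\cap\mathcal{L}^p$, $f_2\in\mathcal{L}^2\cap\mathcal{L}^p$ (defined a.e.). For $f=f_1+f_2$ with $f_1\in\mathcal{L}^1(\mathbb{R})$, $f_2\in BV_0(\mathbb{R})$, and $s\neq0$, the $HK$-Fourier transform is $\mathcal{F}_{HK}(f)(s)=\frac{1}{\sqrt{2\pi}}\int_{\mathbb{R}}e^{-isx}f(x)\,dx$, the integral being the Henstock–Kurzweil integral over $\mathbb{R}$ (which extends the Lebesgue and improper Riemann integrals; it equals $\lim_{T\to\infty}\frac{1}{\sqrt{2\pi}}\int_{-T}^{T}e^{-isx}f(x)dx$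 when it exists). *)

(* Defs.v *)
From HB Require Import structures.
From mathcomp Require Import all_boot all_order all_algebra.
From mathcomp Require Import all_classical all_reals all_analysis.
From mathcomp Require Import complex.
Set Implicit Arguments. Unset Strict Implicit. Unset Printing Implicit Defensive.
Import Order.TTheory GRing.Theory Num.Theory.
Import numFieldNormedType.Exports.
Local Open Scope classical_set_scope.
Local Open Scope ring_scope.

Section Defs.
Variable R : realType.

Definition leb := @lebesgue_measure R.

Definition cnorm (z : R[i]) : R := Num.sqrt (complex.Re z ^+ 2 + complex.Im z ^+ 2).

Definition Lp (p : R) (f : R -> R) : Prop :=
  measurable_fun setT f /\ (Lnorm leb p%:E (EFin \o f) < +oo)%E.

Definition normp (p : R) (f : R -> R) : R := fine (Lnorm leb p%:E (EFin \o f)).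

Definition BV0 (f : R -> R) : Prop :=
  (exists M : R, forall a b, a <= b ->
      bounded_variation a b f /\ (total_variation a b f <= M%:E)%E) /\
  f x @[x --> +oo] --> 0 /\ f x @[x --> -oo] --> 0.

Definition abs_cont_on (a b : R) (f : R -> R) : Prop :=
  forall e : R, 0 < e -> exists2 d : R, 0 < d &
    forall (n : nat) (u v : nat -> R),
      (forall k, (k < n)%N -> a <= u k /\ u k <= v k /\ v k <= b) ->
      (forall k, (k.+1 < n)%N -> v k <= u k.+1) ->
      \sum_(k < n) (v k - u k) < d ->
      \sum_(k < n) `|f (v k) - f (u k)| < e.

Definition AC_loc (f : R -> R) : Prop := forall a b, a <= b -> abs_cont_on a b f.

Definition cF : R := (Num.sqrt (2 * pi))^-1.

(* F_1(f)(s) = 1/sqrt(2pi) int e^{-isx} f(x) dx  for real f in L^1,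
   e^{-isx} = cos(sx) - i sin(sx) *)
Definition F1 (f : R -> R) (s : R) : R[i] :=
  Complex (cF * Rintegral leb setT (fun x => cos (s * x) * f x))
          (- (cF * Rintegral leb setT (fun x => sin (s * x) * f x))).

(* h is (a representative of) the Plancherel transform F_2(f) of f in L^2:
   h is measurable, in L^2, and F_1(u_n) -> h in L^2 for every sequence u_n in
   L^1 cap L^2 converging to f in L^2 *)
Definition IsF2 (f : R -> R) (h : R -> R[i]) : Prop :=
  measurable_fun setT (fun s => complex.Re (h s)) /\
  measurable_fun setT (fun s => complex.Im (h s)) /\
  (Lnorm leb 2%:E (EFin \o (fun s => cnorm (h s))) < +oo)%E /\
  forall u : nat -> R -> R,
    (forall n, Lp 1 (u n) /\ Lp 2 (u n)) ->
    Lnorm leb 2%:E (EFin \o (fun x => u n x - f x)) @[n --> \oo] --> 0%E ->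
    Lnorm leb 2%:E (EFin \o (fun s => cnorm (F1 (u n) s - h s))) @[n --> \oo]
      --> 0%E.

Definition IsFp (p : R) (f : R -> R) (g : R -> R[i]) : Prop :=
  if p == 1 then {ae leb, forall s, g s = F1 f s}
  else if p < 2 then
    exists (f1 f2 : R -> R) (h : R -> R[i]),
      [/\ Lp 1 f1 /\ Lp p f1, Lp 2 f2 /\ Lp p f2,
          (forall x, f x = f1 x + f2 x), IsF2 f2 h &
          {ae leb, forall s, g s = F1 f1 s + h s}]
  else IsF2 f g.

Definition HK_on (a b : R) (g : R -> R) (v : R) : Prop :=
  a <= b /\
  forall e : R, 0 < e -> exists delta : R -> R, (forall x, 0 < delta x) /\
    forall (n : nat) (x t : nat -> R),
      x 0%N = a -> x n = b ->
      (forall i, (i < n)%N -> x i <= t i /\ t i <= x i.+1) ->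
      (forall i, (i < n)%N -> t i - delta (t i) < x i /\
                              x i.+1 < t i + delta (t i)) ->
      `| \sum_(i < n) g (t i) * (x i.+1 - x i) - v | < e.

(* Henstock--Kurzweil integral over R, via Hake's theorem: g is HK-integrable
   on every compact interval and int_a^b g -> I as a -> -oo, b -> +oo *)
Definition HK_R (g : R -> R) (I : R) : Prop :=
  (forall a b, a <= b -> exists v, HK_on a b g v) /\
  forall e : R, 0 < e -> exists M : R, forall a b v,
    a <= - M -> M <= b -> HK_on a b g v -> `|v - I| < e.

(* the value of the HK integral over R (0 if it does not exist) *)
Definition HKint (g : R -> R) : R := xget 0 [set I | HK_R g I].

(* F_HK(f)(s) = 1/sqrt(2 pi) HK-int e^{-isx} f(x) dx (meaningful for s != 0) *)
Definition FHK (f : R -> R) (s : R) : R[i] :=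
  Complex (cF * HKint (fun x => cos (s * x) * f x))
          (- (cF * HKint (fun x => sin (s * x) * f x))).

Definition Cinf0 (F : R -> R[i]) : Prop :=
  (forall s, s != 0 -> cnorm (F t - F s) @[t --> s] --> 0) /\
  cnorm (F t) @[t --> +oo] --> 0 /\ cnorm (F t) @[t --> -oo] --> 0.

End Defs.

(* Main.v *)
Require Import Defs.
From HB Require Import structures.
From mathcomp Require Import all_boot all_order all_algebra.
From mathcomp Require Import all_classical all_reals all_analysis.
From mathcomp Require Import complex.
From mathcomp Require Import ring lra.
From mathcomp Require Import measurable_realfun.
Import Order.TTheory GRing.Theory Num.Theory.
Import numFieldNormedType.Exports.
Local Open Scope classical_set_scope.
Local Open Scope ring_scope.
Local Open Scope complex_scope.

(* The variation of an absolutely continuous function is absolutely continuous, so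
   phi is a difference of nondecreasing absolutely continuous functions; their
   Stieltjes measures are dominated by Lebesgue measure, and Radon-Nikodym with
   Lebesgue differentiation gives the fundamental theorem of calculus for phi, with
   phi' integrable because the total variation is bounded.

   On compact intervals the integrands are continuous, so that the Henstock-Kurzweil
   integral is the Lebesgue one.  Integrating by parts and letting the boundary
   terms vanish gives (iii), hence (iv) and (i).

   A bounded function in L^p with p <= 2 is in L^2, so for 1 < p one may take f1 = 0
   and f2 = phi.  The Plancherel inequality for functions in L^1 and L^2 follows by
   Abel summation: damping the transform by exp(- e |s|) produces the Poisson kernel.
   Applied to the truncations of u_n - phi to [-m, m], it passes to the limit m -> oo
   by Fatou's lemma and bounds the L^2 distance between the transforms of u_n and phi
   by that between u_n and phi. *)

Set Implicit Arguments. Unset Strict Implicit. Unset Printing Implicit Defensive.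

(** [IsF2] asks for L^2 convergence along every approximating sequence u_n, and the transform is
    linear. Hence the upper bound in Plancherel's theorem, applied to u_n - phi, suffices. The
    obstacle is that u_n - phi need not be integrable: its transform exists only as a limit of
    integrals over growing bounded intervals, and only for s != 0. The inequality is therefore
    established for functions given with such conditional limits, and the uncontrolled value at s =
    0 is absorbed by a null set. Two definitions by default value cost work elsewhere. [HKint]
    selects its value by choice, so evaluating it requires uniqueness of the integral, which rests
    on Cousin's lemma. [derive1] is defined at every point, differentiable or not, so its
    measurability is a question apart from the existence of a density. The constant 2 pi of the
    Plancherel inequality is twice the mass pi of the kernel e / (e^2 + z^2), once for each
    half-line; it cancels against [cF] squared. *)

Section total_variation_chains.
Context {R : realType}.
Implicit Types (f : R -> R) (L : seq (R * R)).

(** * Absolute continuity and total variation along chains of intervals *)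

Fixpoint chain (lo hi : R) L : bool :=
  if L is uv :: L' then [&& lo <= uv.1, uv.1 <= uv.2 & chain uv.2 hi L']
  else lo <= hi.

Lemma chain_le lo hi L : chain lo hi L -> lo <= hi.
Proof.
elim: L lo => //= -[u v] L IH lo /= /and3P[lou uv /IH vhi].
by rewrite (le_trans lou)// (le_trans uv).
Qed.

Lemma chain_nth x0 lo hi L k : chain lo hi L -> (k < size L)%N ->
  [/\ lo <= (nth x0 L k).1, (nth x0 L k).1 <= (nth x0 L k).2 &
      (nth x0 L k).2 <= hi].
Proof.
elim: L lo k => //= -[u v] L IH lo [|k] /= /and3P[lou uv c].
  by move=> _; split => //; exact: chain_le c.
rewrite ltnS => /(IH _ _ c)[vl ? ?]; split => //.
by rewrite (le_trans lou)// (le_trans uv).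
Qed.

Lemma chain_nthS x0 lo hi L k : chain lo hi L -> (k.+1 < size L)%N ->
  (nth x0 L k).2 <= (nth x0 L k.+1).1.
Proof.
elim: L lo k => //= -[u v] L IH lo [|k] /= /and3P[lou uv c].
  by rewrite ltnS => /(chain_nth x0 c)[].
by rewrite ltnS => /(IH _ _ c).
Qed.

(** Lists can be cut, concatenated and refined interval by interval, which the indexed families of
    [abs_cont_on] make awkward. *)
Lemma abs_cont_chain a b f : abs_cont_on a b f -> forall e, 0 < e ->
  exists2 d, 0 < d & forall L, chain a b L ->
    \sum_(uv <- L) (uv.2 - uv.1) < d ->
    \sum_(uv <- L) `|f uv.2 - f uv.1| < e.
Proof.
move=> acf e /acf[d d0 H]; exists d => // L cL.
rewrite !(big_nth (a, a)) !big_mkord => Ld.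
apply: (H _ (fun k => (nth (a, a) L k).1) (fun k => (nth (a, a) L k).2)) => //.
  by move=> k kL; have [] := chain_nth (a, a) cL kL.
by move=> k kL; exact: chain_nthS cL kL.
Qed.

Lemma chain_iota lo b (u v : nat -> R) m n : lo <= b ->
  ((0 < n)%N -> lo <= u m) ->
  (forall k, (m <= k < m + n)%N -> u k <= v k /\ v k <= b) ->
  (forall k, (m <= k)%N -> (k.+1 < m + n)%N -> v k <= u k.+1) ->
  chain lo b [seq (u k, v k) | k <- iota m n].
Proof.
elim: n m lo => [|n IH] m lo lob //= lou uvb vu.
have [umvm vmb] : u m <= v m /\ v m <= b by apply: uvb; rewrite leqnn -{1}(addn0 m) ltn_add2l.
rewrite lou//= umvm/=; apply: IH => //.
- by move=> n0; apply: vu => //; rewrite addnS ltnS -addn1 leq_add2l.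
- by move=> k /andP[mk kmn]; apply: uvb; rewrite (ltnW mk) addnS -addSn.
- by move=> k mk kmn; apply: vu; rewrite ?(ltnW mk)// addnS -addSn.
Qed.

Lemma chain_pairmap (u : R) hi s L : path <%R u s -> chain (last u s) hi L ->
  chain u hi (pairmap pair u s ++ L).
Proof.
elim: s u => //= x s IH u /andP[ux xs] c.
by rewrite lexx ltW//= IH.
Qed.

Lemma chain_catW lo hi L1 L2 L2' :
  (forall lo', chain lo' hi L2 -> chain lo' hi L2') ->
  chain lo hi (L1 ++ L2) -> chain lo hi (L1 ++ L2').
Proof.
move=> H; elim: L1 lo => [|uv L1 IH] lo /=; first exact: H.
by move=> /and3P[-> -> /IH].
Qed.

Lemma chain_widen lo lo' hi L : lo <= lo' -> chain lo' hi L -> chain lo hi L.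
Proof.
case: L => [|uv L] /= ll; first exact: le_trans.
by move=> /and3P[l -> ->]; rewrite (le_trans ll).
Qed.

Lemma sum_pairmap (u : R) s :
  \sum_(uv <- pairmap pair u s) (uv.2 - uv.1) = last u s - u.
Proof.
elim: s u => [|x s IH] u /=; first by rewrite big_nil subrr.
by rewrite big_cons IH /=; lra.
Qed.

Lemma variation_pairmap u v f s :
  variation u v f s = \sum_(xy <- pairmap pair u s) `|f xy.2 - f xy.1|.
Proof.
rewrite /variation (big_nth (u, u)) size_pairmap; apply: eq_big_nat => i /= si.
by rewrite (nth_pairmap v).
Qed.

(* The total variations are replaced one interval at a time by sums over
   partitions: this keeps the total length of the chain. *)
Lemma tv_chain a b f : abs_cont_on a b f -> forall e, 0 < e ->
  exists2 d, 0 < d & forall L, chain a b L ->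
    \sum_(uv <- L) (uv.2 - uv.1) < d ->
    \sum_(uv <- L) fine (total_variation uv.1 uv.2 f) <= e.
Proof.
move=> /abs_cont_chain acf e /acf[d d0 H]; exists d => // L0 cL0 L0d.
have main L1 L2 : chain a b (L1 ++ L2) ->
    \sum_(uv <- L1 ++ L2) (uv.2 - uv.1) < d ->
    \sum_(uv <- L1) fine (total_variation uv.1 uv.2 f) +
    \sum_(uv <- L2) `|f uv.2 - f uv.1| <= e.
  elim/last_ind: L1 L2 => [|L1 [u v] IH] L2.
    by move=> c l; rewrite big_nil add0r ltW// H.
  rewrite cat_rcons => c; rewrite big_cat/= big_cons/= => l.
  rewrite -cats1 big_cat/= big_seq1/=.
  have uv : u <= v.
    elim: {IH l} L1 (a) c => [|? ? IH] a' /=; first by case/and3P.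
    by case/and3P => _ _ /IH.
  suff : (total_variation u v f <= (e - \sum_(uv <- L2) `|f uv.2 - f uv.1| -
      \sum_(uv <- L1) fine (total_variation uv.1 uv.2 f))%:E)%E.
    have := total_variation_ge0 f uv.
    case: (total_variation u v f) => [r| |] //=; rewrite lee_fin => r0.
    by rewrite lee_fin; lra.
  apply: ge_ereal_sup => _ [_ [s [us /eqP sv] <-] <-].
  rewrite lee_fin variation_pairmap.
  have := IH (pairmap pair u s ++ L2); rewrite big_cat/=.
  have cs : chain a b (L1 ++ pairmap pair u s ++ L2).
    apply: chain_catW c => lo' /= /and3P[lou _ cv].
    by apply: (chain_widen lou); apply: chain_pairmap => //; rewrite sv.
  rewrite !big_cat/= sum_pairmap sv => /(_ cs l); lra.
by have := main L0 [::]; rewrite cats0 big_nil addr0; apply.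
Qed.

Lemma abs_cont_tv a b f : bounded_variation a b f -> abs_cont_on a b f ->
  abs_cont_on a b (fun x => fine (total_variation a x f)).
Proof.
move=> bvf /tv_chain acf e e0; have e20 : 0 < e / 2 by rewrite divr_gt0.
have [d d0 H] := acf _ e20; exists d => // n u v uvb vu uvd.
have [ab|ab] := leP a b; last first.
  case: n uvb vu uvd => [|n] uvb _ _; first by rewrite big_ord0.
  by have [? [? ?]] := uvb 0%N erefl; lra.
have fin x y : a <= x -> x <= y -> y <= b -> total_variation x y f \is a fin_num.
  move=> ax xy yb; apply/bounded_variationP => //.
  apply: (@bounded_variationl _ x y b) => //; apply: (@bounded_variationr _ a x b) => //.
  exact: le_trans yb.
(* [tv_chain] bounds a supremum, hence only non-strictly; halving e recovers the strict
   inequality. *)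
rewrite (@le_lt_trans _ _ (e / 2))//; last by lra.
have := H [seq (u k, v k) | k <- iota 0 n].
rewrite !big_map /=.
rewrite (_ : iota 0 n = index_iota 0 n); last by rewrite /index_iota subn0.
rewrite !big_mkord /=.
rewrite (_ : \sum_(k < n) `| _ | = \sum_(i < n) fine (total_variation (u i) (v i) f)); last first.
  apply: eq_bigr => i _; have [au [uv vb]] := uvb i (ltn_ord i).
  rewrite (total_variationD f au uv) fineD ?fin//; last first.
    exact: le_trans vb.
  rewrite addrC addKr ger0_norm// fine_ge0//.
  exact: total_variation_ge0.
apply => //; rewrite /index_iota subn0; apply: chain_iota => //.
- by move=> n0; have [] := uvb 0%N n0.
- by move=> k; rewrite add0n => /andP[_ /uvb[_]].
- by move=> k _; rewrite add0n => /vu.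
Qed.

Lemma abs_cont_unif a b f : abs_cont_on a b f -> forall e, 0 < e ->
  exists2 d, 0 < d & forall x y, a <= x -> x <= y -> y <= b -> y - x < d ->
    `|f y - f x| < e.
Proof.
move=> acf e /acf[d d0 H]; exists d => // x y ax xy yb xyd.
have := H 1%N (fun=> x) (fun=> y); rewrite !big_ord1; apply => //.
Qed.

End total_variation_chains.

(** * Densities of nondecreasing absolutely continuous functions *)

Section stieltjes_density.
Context {R : realType}.
Variables (a b : R) (G : R -> R).
Hypothesis ab : a < b.
Hypothesis ndG : forall x y, a <= x -> x <= y -> y <= b -> G x <= G y.
Hypothesis acG : abs_cont_on a b G.

Definition clamp (x : R) := Num.max a (Num.min x b).

Lemma clamp_in x : a <= clamp x <= b.
Proof. by rewrite /clamp le_max lexx/= ge_max (ltW ab) ge_min lexx orbT. Qed.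

Lemma clamp_id x : a <= x <= b -> clamp x = x.
Proof. by move=> /andP[ax xb]; rewrite /clamp min_l// max_r. Qed.

Lemma clampP x : (x <= a /\ clamp x = a) \/
  [/\ a <= x, x <= b & clamp x = x] \/ (b <= x /\ clamp x = b).
Proof.
rewrite /clamp; case: (leP x b) => xb; last first.
  by right; right; split; [exact: ltW|rewrite max_r// ltW].
case: (leP a x) => ax; first by right; left.
by left; split => //; exact: ltW.
Qed.

Lemma clamp_le x y : x <= y -> clamp x <= clamp y.
Proof. have ab' := ab; move=> xy; have := clampP x; have := clampP y.
by case=> [[? ->]|[[? ? ->]|[? ->]]]; case=> [[? ->]|[[? ? ->]|[? ->]]]; lra.
Qed.

Lemma clamp_lip x y : x <= y -> clamp y - clamp x <= y - x.
Proof.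
have ab' := ab; move=> xy; have := clampP x; have := clampP y.
by case=> [[? ->]|[[? ? ->]|[? ->]]]; case=> [[? ->]|[[? ? ->]|[? ->]]]; lra.
Qed.

(** Extended by constants outside [a, b], because a Stieltjes measure is built from a function that
    is nondecreasing and right-continuous on the whole line. *)
Definition Gc (x : R) := G (clamp x).

Lemma Gc_nondecreasing : nondecreasing Gc.
Proof.
by move=> x y xy; apply: ndG; [by have /andP[] := clamp_in x|exact: clamp_le|
  by have /andP[] := clamp_in y].
Qed.

Lemma Gc_continuous : continuous Gc.
Proof.
move=> x; apply/(@cvgrPdist_lt _ R^o) => e /(abs_cont_unif acG)[d d0 H].
near=> y.
have : `|x - y| < d by near: y; exact: (@cvgr_dist_lt _ R^o).
have /andP[? ?] := clamp_in x; have /andP[? ?] := clamp_in y.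
have [xy|yx] := leP x y.
  rewrite distrC ger0_norm ?subr_ge0// => yxd.
  rewrite distrC; apply: H => //; first exact: clamp_le.
  by apply: le_lt_trans yxd; exact: clamp_lip.
rewrite gtr0_norm ?subr_gt0// => xyd; apply: H => //; first by apply/clamp_le/ltW.
by apply: le_lt_trans xyd; apply/clamp_lip/ltW.
Unshelve. all: by end_near. Qed.

Lemma Gc_right_continuous : right_continuous Gc.
Proof. by apply: right_continuousW; exact: Gc_continuous. Qed.

HB.instance Definition _ := isCumulative.Build R _ R Gc Gc_nondecreasing Gc_right_continuous.

Local Notation mu := (lebesgue_stieltjes_measure Gc).
Local Notation leb := (@lebesgue_measure R).

Lemma stieltjes_itv x y : x <= y -> mu `]x, y] = (Gc y - Gc x)%:E.
Proof.
move=> xy; rewrite /lebesgue_stieltjes_measure /measure_extension measurable_mu_extE/=; last exact: is_ocitv.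
by rewrite wlength_itv_bnd.
Qed.

Lemma lebesgue_itv x y : x <= y -> leb `]x, y] = (y - x)%:E.
Proof.
move=> xy; rewrite lebesgue_measure_itv/= lte_fin.
by case: ltgtP xy => // ->; rewrite subrr.
Qed.

Definition gridpt n k : R := a + k%:R * ((b - a) / n.+1%:R).
(** A cell not contained in U is collapsed to an empty interval. The family thus keeps its n.+1
    members whatever U is, and can be given to [abs_cont_on] without filtering. *)
Definition gridsel (U : set R) n k : R :=
  if `[< `]gridpt n k, gridpt n k.+1]%classic `<=` U >] then gridpt n k.+1
  else gridpt n k.
Definition gridcell (U : set R) n k : set R := `]gridpt n k, gridsel U n k]%classic.
Definition gridset (U : set R) n := \big[setU/set0]_(k < n.+1) gridcell U n k.

Lemma grid_step n : 0 < (b - a) / n.+1%:R.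
Proof. by rewrite divr_gt0// subr_gt0. Qed.

Lemma gridptS n k : gridpt n k.+1 = gridpt n k + (b - a) / n.+1%:R.
Proof. by rewrite /gridpt -natr1 mulrDl mul1r addrA. Qed.

Lemma gridpt0 n : gridpt n 0 = a.
Proof. by rewrite /gridpt mul0r addr0. Qed.

Lemma gridptn n : gridpt n n.+1 = b.
Proof. by rewrite /gridpt mulrC divfK ?pnatr_eq0// addrC subrK. Qed.

Lemma gridpt_le n : {homo gridpt n : k l / (k <= l)%N >-> k <= l}.
Proof.
move=> k l kl; rewrite /gridpt lerD2l ler_wpM2r ?ler_nat//.
exact/ltW/grid_step.
Qed.

Lemma gridsel_ge U n k : gridpt n k <= gridsel U n k.
Proof. by rewrite /gridsel; case: ifP => // _; exact: gridpt_le. Qed.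

Lemma gridsel_le U n k : gridsel U n k <= gridpt n k.+1.
Proof. by rewrite /gridsel; case: ifP => // _; exact: gridpt_le. Qed.

Lemma gridcell_sub U n k : gridcell U n k `<=` U.
Proof.
rewrite /gridcell /gridsel; case: ifPn => [/asboolP //|_].
by rewrite set_itvoc0.
Qed.

Lemma gridcell_meas U n k : measurable (gridcell U n k).
Proof. exact: measurable_itv. Qed.

Lemma gridset_meas U n : measurable (gridset U n).
Proof. by apply: bigsetU_measurable => k _; exact: gridcell_meas. Qed.

Lemma gridset_sub U n : gridset U n `<=` U.
Proof. by rewrite /gridset; elim/big_ind : _ => // [A B|i _]; [rewrite subUset; split|exact: gridcell_sub]. Qed.

Lemma gridcell_triv U n : trivIset setT (gridcell U n).
Proof.
apply: ltn_trivIset => j i ij.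
rewrite -subset0 => x; rewrite /gridcell => -[]; rewrite /= !in_itv/= => /andP[_ xj] /andP[ix _].
have H := le_trans (gridsel_le U n i) (gridpt_le n ij).
by have := le_lt_trans (le_trans xj H) ix; rewrite ltxx.
Qed.

Lemma lebesgue_gridset U n :
  leb (gridset U n) = (\sum_(k < n.+1) (gridsel U n k - gridpt n k))%:E.
Proof.
rewrite /gridset measure_bigsetU; [|exact: gridcell_meas|exact: gridcell_triv].
rewrite -sumEFin; apply: eq_bigr => i _; apply: lebesgue_itv; exact: gridsel_ge.
Qed.

Lemma stieltjes_gridset U n :
  mu (gridset U n) = (\sum_(k < n.+1) (Gc (gridsel U n k) - Gc (gridpt n k)))%:E.
Proof.
rewrite /gridset measure_bigsetU; [|exact: gridcell_meas|exact: gridcell_triv].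
rewrite -sumEFin; apply: eq_bigr => i _; apply: stieltjes_itv; exact: gridsel_ge.
Qed.

Lemma gridpt_in n k : (k <= n.+1)%N -> a <= gridpt n k <= b.
Proof. by move=> kn; rewrite -{1}(gridpt0 n) -(gridptn n) !gridpt_le. Qed.

(** The half-open cells cover []a, b]], and once the mesh is smaller than the radius r of a ball
    around x inside U, the cell of x lies in U. This holds for all large n, not just for some, as
    the tail intersections in [stieltjes_dominated] require. *)
Lemma gridset_near U x : open U -> U x -> a < x <= b ->
  exists N, forall n, (N <= n)%N -> gridset U n x.
Proof.
move=> oU Ux /andP[ax xb].
have /nbhs_ballP[r /= r0 rU] : nbhs x U by exact: open_nbhs_nbhs.
have [N Nr] : exists N : nat, (b - a) / r < N%:R.
  exists (Num.bound ((b - a) / r)); apply: archi_boundP.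
  by rewrite divr_ge0// ?ltW// subr_gt0.
exists N => n Nn.
have hr : (b - a) / n.+1%:R < r.
  rewrite ltr_pdivrMr// mulrC -ltr_pdivrMr//; apply: lt_le_trans Nr _.
  by rewrite ler_nat (leq_trans Nn).
have ex : exists k, x <= gridpt n k by exists n.+1; rewrite gridptn.
(* The least grid point at or to the right of x closes the cell of x; its index is not 0 because a <
   x. *)
case: (ex_minnP ex) => -[|k]; first by rewrite gridpt0 leNgt ax.
move=> xk kmin; have kx : gridpt n k < x.
  by rewrite ltNge; apply/negP => /kmin; rewrite ltnn.
have kn : (k < n.+1)%N.
  by apply: kmin; rewrite gridptn.
rewrite /gridset -bigcup_mkord; exists k => //=.
rewrite /gridcell /gridsel asboolT/=; first by rewrite in_itv/= kx.
move=> y /=; rewrite in_itv/= => /andP[ky yk]; apply: rU.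
rewrite /ball/= ltr_norml; move: xk yk hr; rewrite !gridptS.
by move: ((b - a) / n.+1%:R) => h ? ? ?; apply/andP; split; lra.
Qed.

(* A Lebesgue-null set is covered by an open U of small measure; the cells of
   finer and finer uniform grids that lie inside U exhaust U, and absolute
   continuity bounds the increment of G over each such finite family. *)
Lemma stieltjes_dominated A : measurable A -> leb A = 0 -> mu (A `&` `]a, b]) = 0.
Proof.
move=> mA A0; apply/eqP; rewrite eq_le measure_ge0 andbT.
apply/lee_addgt0Pr => e e0; rewrite add0e.
have [d d0 H] := acG e0.
have mA' : measurable (A `&` `]a, b]) by apply: measurableI.
have A'0 : leb (A `&` `]a, b]) = 0.
  apply/eqP; rewrite eq_le measure_ge0 andbT -A0 le_measure// ?inE//.
have [|U [oU A'U Ud]] := lebesgue_regularity_outer mA' _ d0.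
  by rewrite [X in (X < _)%E]A'0.
have mU : measurable U by exact: measurable_realfun.open_measurable.
have Ud' : (leb U < d%:E)%E.
  apply: le_lt_trans Ud; rewrite -(setDUK A'U).
  rewrite (le_trans (measureU2 _ _ _))//; first exact: measurableD.
  by rewrite [X in (X + _)%E]A'0 add0e setDUK.
have muD n : (mu (gridset U n) <= e%:E)%E.
  rewrite stieltjes_gridset lee_fin.
  have : (leb (gridset U n) < d%:E)%E.
    apply: le_lt_trans Ud'; apply: le_measure; rewrite ?inE//; last exact: gridset_sub.
    exact: gridset_meas.
  rewrite lebesgue_gridset lte_fin => gd.
  apply/ltW/(le_lt_trans _ (H n.+1 _ _ _ _ gd)).
  - apply: ler_sum => i _.
    have /andP[? ?] := gridpt_in (ltnW (ltn_ord i)).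
    have /andP[? ?] := gridpt_in (ltn_ord i).
    have ? := gridsel_ge U n i. have ? := gridsel_le U n i.
    rewrite /Gc !clamp_id ?ler_norm//; apply/andP; split => //; [exact: le_trans (gridsel_ge U n i)|exact: le_trans (gridsel_le U n i) _].
  - move=> k kn; have /andP[? ?] := gridpt_in (ltnW kn).
    have /andP[? ?] := gridpt_in kn.
    split => //; split; first exact: gridsel_ge.
    exact: le_trans (gridsel_le U n k) _.
  - by move=> k _; exact: gridsel_le.
(* Grids of n.+1 cells are not nested, so [gridset U n] is not monotone in n. The intersections over
   n >= N increase with N, which gives continuity of the measure from below. *)
pose F N := \bigcap_(n in [set n | (N <= n)%N]) gridset U n.
have mF N : measurable (F N).
  by apply: bigcap_measurable => [|n _]; [exists N => /=|exact: gridset_meas].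
have mFU : measurable (\bigcup_N F N) by exact: bigcup_measurable.
have ndF : {homo F : n m / (n <= m)%N >-> (n <= m)%O}.
  move=> n m nm; apply/subsetPset => x Fx k /= mk; apply: Fx => /=.
  exact: leq_trans mk.
have muF := nondecreasing_cvg_mu (mu := mu) mF mFU ndF.
apply: (@le_trans _ _ (mu (\bigcup_N F N))).
  apply: le_measure; rewrite ?inE//.
  move=> x xA'; have [] := gridset_near oU (A'U _ xA').
    by case: xA' => _ /=; rewrite in_itv.
  by move=> N HN; exists N => // n /= Nn; exact: HN.
apply: (cvge_to_le muF).
apply: nearW => N /=; apply: le_trans (muD N).
apply: le_measure; do ?[by rewrite inE; exact: mF|by rewrite inE; exact: gridset_meas].
by move=> x Fx; exact: Fx N (leqnn N).
Qed.

Lemma abs_cont_density : exists g : R -> R,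
  [/\ forall x, 0 <= g x, leb.-integrable setT (EFin \o g) &
   forall x y, a <= x -> x <= y -> y <= b ->
     (\int[leb]_(t in `]x, y]) (g t)%:E = (G y - G x)%:E)%E].
Proof.
have fin : (mu `]a, b] < +oo)%E by rewrite stieltjes_itv ?ltry// ltW.
(* The restriction has mass G b - G a, and it is on subsets of []a, b]] that domination has been
   shown. *)
pose nu : {finite_measure set (measurableTypeR R) -> \bar R} :=
  mfrestr (T := measurableTypeR R) (D := `]a, b]) (f := mu) (measurable_itv `]a, b]) fin.
have dom : nu `<< leb.
  apply/null_content_dominatesP => A mA A0.
  exact: stieltjes_dominated.
pose g := Radon_Nikodym_SigmaFinite.f nu leb.
have gfin x : g x \is a fin_num by exact: Radon_Nikodym_SigmaFinite.f_fin_num.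
exists (fine \o g); split.
- by move=> x; apply: fine_ge0; exact: Radon_Nikodym_SigmaFinite.f_ge0.
- rewrite (_ : _ \o _ = g); first exact: Radon_Nikodym_SigmaFinite.f_integrable.
  by apply/funext => x /=; rewrite fineK.
- move=> x y ax xy yb; under eq_integral do rewrite /= fineK//.
  rewrite -Radon_Nikodym_SigmaFinite.f_integral//= /mfrestr /mrestr setIidl; last first.
    move=> z /=; rewrite !in_itv/= => /andP[xz zy].
    by rewrite (le_lt_trans ax)//= (le_trans zy).
  rewrite stieltjes_itv// /Gc !clamp_id//.
    by rewrite ax (le_trans xy).
  by rewrite yb (le_trans ax).
Qed.

End stieltjes_density.

(** * Fundamental theorem of calculus for absolutely continuous functions *)

Section ftc.
Context {R : realType}.
Local Notation mu := (@lebesgue_measure R).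
Implicit Types (f : R -> R).

Lemma ae_mono (P Q : R -> Prop) : (forall x, P x -> Q x) ->
  {ae mu, forall x, P x} -> {ae mu, forall x, Q x}.
Proof. by move=> PQ; exact: (@filterS _ _ (ae_filter_ringOfSetsType mu) P Q PQ). Qed.

Lemma ae_and (P Q : R -> Prop) : {ae mu, forall x, P x} ->
  {ae mu, forall x, Q x} -> {ae mu, forall x, P x /\ Q x}.
Proof. by move=> aP aQ; apply: filterS2 aP aQ => //; exact: (ae_filter_ringOfSetsType mu). Qed.

Lemma tv_fin a b f x y : bounded_variation a b f -> a <= x -> x <= y -> y <= b ->
  total_variation x y f \is a fin_num.
Proof.
move=> bvf ax xy yb; apply/bounded_variationP => //.
apply: (@bounded_variationl _ x y b) => //; apply: (@bounded_variationr _ a x b) => //.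
exact: le_trans yb.
Qed.

Lemma tv_addl a b f x y : bounded_variation a b f -> a <= x -> x <= y -> y <= b ->
  fine (total_variation a y f) =
  fine (total_variation a x f) + fine (total_variation x y f).
Proof.
move=> bvf ax xy yb; rewrite (total_variationD f ax xy) fineD//.
  by apply: (tv_fin bvf) => //; exact: le_trans yb.
exact: (tv_fin bvf).
Qed.

Lemma tv_ge_norm a b f x y : bounded_variation a b f -> a <= x -> x <= y -> y <= b ->
  `|f y - f x| <= fine (total_variation x y f).
Proof.
move=> bvf ax xy yb; have := total_variation_ge f xy.
by rewrite -(fineK (tv_fin bvf ax xy yb)) lee_fin.
Qed.

(** Decompose f = V - (V - f) with V the variation from a. The integrals of the two densities add up
    to 2 V b - (f b - f a), at most three times the variation; this is the origin of the 3, and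
    finiteness is all that is asked of it. *)
Lemma abs_cont_primitive a b f : a < b -> bounded_variation a b f ->
  abs_cont_on a b f ->
  exists g : R -> R, [/\ mu.-integrable setT (EFin \o g),
    forall x, a <= x -> x <= b -> f x - f a = \int[mu]_(t in `]a, x]) g t &
    \int[mu]_(t in `]a, b]) `|g t| <= 3 * fine (total_variation a b f)].
Proof.
move=> ab bvf acf.
pose V x := fine (total_variation a x f).
have acV : abs_cont_on a b V by exact: abs_cont_tv.
have ndV x y : a <= x -> x <= y -> y <= b -> V x <= V y.
  move=> ax xy yb; rewrite /V (tv_addl bvf ax xy yb) lerDl fine_ge0//.
  exact: total_variation_ge0.
have ndW x y : a <= x -> x <= y -> y <= b -> V x - f x <= V y - f y.
  move=> ax xy yb; rewrite /V (tv_addl bvf ax xy yb).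
  have := tv_ge_norm bvf ax xy yb; have := ler_norm (f y - f x); lra.
have acW : abs_cont_on a b (fun x => V x - f x).
  move=> e e0; have e20 : 0 < e / 2 by rewrite divr_gt0.
  have [d1 d10 H1] := acV _ e20; have [d2 d20 H2] := acf _ e20.
  exists (Num.min d1 d2); first by rewrite lt_min d10.
  move=> n u v uvb vu; rewrite lt_min => /andP[l1 l2].
  have := H1 n u v uvb vu l1; have := H2 n u v uvb vu l2.
  suff : \sum_(k < n) `|V (v k) - f (v k) - (V (u k) - f (u k))| <=
    \sum_(k < n) `|V (v k) - V (u k)| + \sum_(k < n) `|f (v k) - f (u k)| by lra.
  rewrite -big_split /=; apply: ler_sum => i _.
  rewrite (_ : _ - _ - _ = (V (v i) - V (u i)) - (f (v i) - f (u i))); last by lra.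
  exact: ler_normB.
have [g [g0 ig Vg]] := abs_cont_density ab ndV acV.
have [h [h0 ih Wh]] := abs_cont_density ab ndW acW.
have moc x : measurable (`]a, x]%classic : set R) by exact: measurable_itv.
have igx x : mu.-integrable `]a, x] (EFin \o g) by exact: integrableS ig.
have ihx x : mu.-integrable `]a, x] (EFin \o h) by exact: integrableS ih.
have Vgx x : a <= x -> x <= b -> \int[mu]_(t in `]a, x]) g t = V x - V a.
  by move=> ax xb; rewrite /Rintegral Vg.
have Whx x : a <= x -> x <= b -> \int[mu]_(t in `]a, x]) h t = (V x - f x) - (V a - f a).
  by move=> ax xb; rewrite /Rintegral Wh.
have igh : mu.-integrable setT (EFin \o (g \- h)) by exact: integrableB ig ih.
exists (g \- h); split => //.
  by move=> x ax xb; rewrite RintegralB// Vgx// Whx//; lra.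
apply: (@le_trans _ _ (\int[mu]_(t in `]a, b]) (g t + h t))).
  apply: le_Rintegral => //.
  - by apply: (@integrable_norm _ _ _ mu _ (g \- h)); exact: integrableS igh.
  - exact: integrableD (igx b) (ihx b).
  - move=> x _; rewrite (le_trans (ler_normB _ _))//.
    by rewrite !ger0_norm.
have Eg := Vgx b (ltW ab) (lexx b); have Eh := Whx b (ltW ab) (lexx b).
rewrite RintegralD// Eg Eh.
have := tv_ge_norm bvf (lexx a) (ltW ab) (lexx b).
rewrite /V total_variationxx /=; have := ler_norm (- (f b - f a)); rewrite normrN; lra.
Qed.

Lemma primitive_derivable a b f (g : R -> R) : mu.-integrable setT (EFin \o g) ->
  (forall x, a <= x -> x <= b -> f x - f a = \int[mu]_(t in `]a, x]) g t) ->
  {ae mu, forall x, a < x -> x < b -> derivable f x 1 /\ f^`()%classic x = g x}.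
Proof.
move=> ig fg.
have igy y : mu.-integrable [set` Interval (BRight a) (BRight y)] (EFin \o g).
  by apply: integrableS ig.
have locg : locally_integrable setT g.
  by apply: open_integrable_locally => //; exact: openT.
have := FTC1 igy locg.
apply: ae_mono => x Hx ax xb.
have [|dF F'] := Hx; first by rewrite (@lte_fin R).
pose F := fun x : R => \int[mu]_(t in [set` Interval (BRight a) (BRight x)]) g t.
(* Lebesgue differentiation concerns the primitive of g; f differs from it by a constant near x, so
   it has the same derivative there. *)
have fF : {near x, cst (f a) + F =1 f}.
  have : x \in `]a, b[ by rewrite in_itv/= ax.
  move=> /near_in_itvoo; apply: filterS => y; rewrite in_itv/= => /andP[ay yb].
  change (f a + F y = f y); have := fg y (ltW ay) (ltW yb); rewrite -/(F y); lra.
have dcF : derivable (cst (f a) + F) x 1 by apply: derivableD; [exact: derivable_cst|exact: dF].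
split; first exact: near_eq_derivable dcF.
rewrite derive1E -(near_eq_derive (1 : R) fF) deriveD; [|exact: derivable_cst|exact: dF].
by rewrite derive_cst add0r -F' derive1E.
Qed.

Let dquot f (h x : R) : R := h^-1 * (f (h + x) - f x).

Lemma continuous_diffquot f h : continuous f -> continuous (dquot f h).
Proof.
move=> cf x; apply: cvgM; first exact: cvg_cst.
apply: cvgB; last exact: cf.
apply: (continuous_comp (f := fun y => h + y)) => //.
  by apply: cvgD; [exact: cvg_cst|exact: cvg_id].
exact: cf.
Qed.

(* For continuous f the oscillation sets of the difference quotients are open, so
   the set where the quotients are Cauchy at 0 is Borel; elsewhere the limit
   defining the derivative takes the junk value 0. *)
Let osc f (m k : nat) := [set x | exists h h' : R,
  [/\ h != 0, h' != 0, `|h| < m.+1%:R^-1, `|h'| < m.+1%:R^-1 &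
      k.+1%:R^-1 < `|dquot f h x - dquot f h' x|]].

Let measurable_osc f m k : continuous f -> measurable (osc f m k).
Proof.
move=> cf; apply: open_measurable.
rewrite (_ : osc f m k = \bigcup_(hh in [set hh : R * R |
   [/\ hh.1 != 0, hh.2 != 0, `|hh.1| < m.+1%:R^-1 & `|hh.2| < m.+1%:R^-1]])
   [set x | k.+1%:R^-1 < `|dquot f hh.1 x - dquot f hh.2 x|]); last first.
  apply/seteqP; split => x.
    by move=> [h [h' [? ? ? ? ?]]]; exists (h, h').
  by move=> [[h h'] [/= ? ? ? ?] ?]; exists h, h'.
apply: bigcup_open => -[h h'] _ /=.
have cq : continuous (fun x => `|dquot f h x - dquot f h' x|).
  by move=> x; apply: cvg_norm; apply: cvgB; exact: continuous_diffquot.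
exact: (open_comp (fun x _ => cq x) (@open_gt _ _)).
Qed.

Let diffset f := \bigcap_k \bigcup_m ~` osc f m k.

Let measurable_diffset f : continuous f -> measurable (diffset f).
Proof.
move=> cf; apply: bigcapT_measurable => k; apply: bigcupT_measurable => m.
by apply: measurableC; exact: measurable_osc.
Qed.

Let cvg_diffset f x : diffset f x -> cvg (dquot f h x @[h --> 0^']).
Proof.
move=> Dx; apply/cauchy_cvgP; apply: cauchy_exP => e e0.
have [k ke] : exists k : nat, k.+1%:R^-1 < e.
  have := @near_infty_natSinv_lt R (PosNum e0).
  by case=> N _ /(_ N (leqnn N)) /= H; exists N.
have [m _ Hm] := Dx k I.
have m0 : 0 < (m.+1%:R^-1 : R) by rewrite invr_gt0.
exists (dquot f (m.+1%:R^-1 / 2) x).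
rewrite /fmap /=; near=> h.
rewrite /ball/=; apply: le_lt_trans ke.
rewrite leNgt; apply/negP => kq; apply: Hm; exists (m.+1%:R^-1 / 2), h.
split => //.
- by near: h; rewrite near_withinE; apply: nearW.
- by rewrite gtr0_norm ?divr_gt0// ltr_pdivrMr// ltr_pMr// ltr1n.
- near: h; apply: dnbhs0_lt => //.
Unshelve. all: by end_near. Qed.

Let diffset_cvg f x (l : R) : dquot f h x @[h --> 0^'] --> l -> diffset f x.
Proof.
move=> ql k _.
have e0 : 0 < (k.+1%:R^-1 / 2 : R) by rewrite divr_gt0// invr_gt0.
have /cvgrPdist_lt /(_ _ e0) := ql.
rewrite near_withinE => /nbhs_ballP[d /= d0 H].
have [m md] : exists m : nat, m.+1%:R^-1 < d.
  have := @near_infty_natSinv_lt R (PosNum d0).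
  by case=> N _ /(_ N (leqnn N)) /= H'; exists N.
exists m => // -[h [h' [h0 h'0 hm h'm]]].
have := H h; rewrite /ball/= sub0r normrN => /(_ (lt_trans hm md) h0).
have := H h'; rewrite /ball/= sub0r normrN => /(_ (lt_trans h'm md) h'0).
move=> lq' lq; rewrite ltNge => /negP; apply.
rewrite (_ : dquot f h x - dquot f h' x = (l - dquot f h' x) - (l - dquot f h x)); last by lra.
rewrite (le_trans (ler_normB _ _))//.
by rewrite [leRHS]splitr lerD// ltW.
Qed.

Lemma measurable_derive1 f : continuous f -> measurable_fun setT (f^`()%classic).
Proof.
move=> cf.
(* The increments 1 / (n + 1) suffice where the derivative exists; the indicator makes the sequence
   converge to 0, the default value of the limit, everywhere else. *)
pose qn n x : R := dquot f n.+1%:R^-1 x * \1_(diffset f) x.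
apply: (@measurable_fun_cvg _ _ _ _ qn) => [n|x _].
  apply: measurable_funM.
    by apply: continuous_measurable_fun; exact: continuous_diffquot.
  by apply: measurable_indic; exact: measurable_diffset.
rewrite /qn /= indicE.
have [xD|xD] := pselect (diffset f x).
  under eq_fun do rewrite mem_set// mulr1.
  have qc := cvg_diffset xD.
  have : dquot f n.+1%:R^-1 x @[n --> \oo] --> lim (dquot f h x @[h --> 0^']).
    apply: (cvg_comp (fun n : nat => n.+1%:R^-1) (fun h => dquot f h x) _ qc).
    have h0 : (n.+1%:R^-1 : R) @[n --> \oo] --> 0 by exact: cvg_harmonic.
    move=> A /h0; rewrite /fmap /nbhs/=; apply: filterS => n /=; apply.
    by rewrite invr_eq0 pnatr_eq0.
  by apply.
under eq_fun do rewrite memNset// mulr0.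
rewrite (_ : f^`()%classic x = 0); first exact: cvg_cst.
rewrite /derive1 /lim /lim_in getPN// => l ql; apply: xD.
exact: diffset_cvg ql.
Qed.

(** Passes from the Radon-Nikodym density to the pointwise derivative, which agrees with it almost
    everywhere and is measurable on its own account. *)
Lemma ftc_abs_cont a b f : a < b -> continuous f -> bounded_variation a b f ->
  abs_cont_on a b f ->
  [/\ mu.-integrable `]a, b] (EFin \o f^`()%classic),
      \int[mu]_(t in `]a, b]) f^`()%classic t = f b - f a,
      \int[mu]_(t in `]a, b]) `|f^`()%classic t| <= 3 * fine (total_variation a b f) &
      {ae mu, forall x, a < x -> x < b -> derivable f x 1}].
Proof.
move=> ab cf bvf acf.
have [g [ig fg gb]] := abs_cont_primitive ab bvf acf.
have dfg := primitive_derivable ig fg.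
have mdf := measurable_derive1 cf.
have mg : measurable_fun setT g by have /measurable_int/measurable_EFinP := ig.
(* Differentiability is known inside the open interval only, while the integrals run over []a,
   b]]. *)
have aeb : {ae mu, forall x, x != b}.
  exists [set b]; split => //; first exact: lebesgue_measure_set1.
  by move=> x /= /negP; rewrite negbK => /eqP.
have aefg : ae_eq mu `]a, b]%classic (f^`()%classic) g.
  apply: ae_mono (ae_and aeb dfg) => x [xb H] /=; rewrite in_itv/= => /andP[ax xb'].
  by have [] := H ax (_ : x < b) => //; rewrite lt_neqAle xb.
have igab : mu.-integrable `]a, b] (EFin \o g) by exact: integrableS ig.
have moc : measurable (`]a, b]%classic : set R) by exact: measurable_itv.
have aefgE (k : R -> R) : measurable_fun setT k ->
   (\int[mu]_(t in `]a, b]) (k (f^`()%classic t))%:E = \int[mu]_(t in `]a, b]) (k (g t))%:E)%E.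
  move=> mk; apply: ae_eq_integral => //.
  - by apply/measurable_EFinP/measurable_funTS/measurableT_comp.
  - by apply/measurable_EFinP/measurable_funTS/measurableT_comp.
  - by apply: ae_mono aefg => x /= H /H ->.
split.
- apply/integrableP; split; first by apply/measurable_EFinP/measurable_funTS.
  under eq_integral do rewrite /=.
  rewrite (aefgE Num.norm)//.
  by have /integrableP[] := igab.
- by rewrite /Rintegral (aefgE id)// -/(Rintegral _ _ _) -fg// ltW.
- by rewrite /Rintegral (aefgE Num.norm).
- by apply: ae_mono dfg => x H ax xb; have [] := H ax xb.
Qed.

End ftc.

(** * The Henstock-Kurzweil integral of continuous functions *)

Section HK.
Context {R : realType}.
Local Notation mu := (@lebesgue_measure R).
Implicit Types (g : R -> R).

Definition fine_part (a b : R) (delta : R -> R) (n : nat) (x t : nat -> R) :=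
  [/\ x 0%N = a, x n = b,
      forall i, (i < n)%N -> x i <= t i /\ t i <= x i.+1 &
      forall i, (i < n)%N -> t i - delta (t i) < x i /\ x i.+1 < t i + delta (t i)].

(** Cousin's lemma. Without fine partitions the condition in [HK_on] would hold vacuously for every
    value. The proof takes the supremum c of the points reachable from a by a fine partition. *)
Lemma cousin (a b : R) (delta : R -> R) : a <= b -> (forall x, 0 < delta x) ->
  exists n x t, fine_part a b delta n x t.
Proof.
move=> ab d0.
pose S := [set y | a <= y <= b /\ exists n x t, fine_part a y delta n x t].
have Sa : S a.
  by split; [rewrite lexx|exists 0%N, (fun=> a), (fun=> a); split].
have supS : has_sup S.
  by split; [exists a|exists b => y [/andP[]]].
set c := sup S.
have ac : a <= c by apply: ub_le_sup => //; case: supS.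
have cb : c <= b by apply: ge_sup => // [|y [/andP[]] //]; exists a.
have [y [/andP[ay yb] [n [x [t [x0 xn xt dt]]]]] yc] : exists2 y, S y & c - delta c < y.
  by apply: sup_adherent => //.
have ylec : y <= c by apply: ub_le_sup; [case: supS|split; [rewrite ay|exists n, x, t]].
(* One more interval, from y to z and tagged by c, is still fine because c - delta c < y and z < c +
   delta c. So z is reachable, z <= c, and this forces z = b. *)
pose z := Num.min b (c + delta c / 2).
have cz : c <= z by rewrite /z le_min cb lerDl divr_ge0// ltW.
have zd : z < c + delta c.
  rewrite /z gt_min; apply/orP; right; rewrite ltrD2l.
  by rewrite ltr_pdivrMr// ltr_pMr// ltr1n.
have Sz : exists n x t, fine_part a z delta n x t.
  exists n.+1, (fun i => if (i <= n)%N then x i else z), (fun i => if (i < n)%N then t i else c).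
  split => //=.
  - by rewrite ltnn.
  - move=> i; rewrite ltnS => ilen; rewrite ilen; case: (ltnP i n) => [ilt|nle].
      exact: xt.
    by have -> : i = n by [apply/eqP; rewrite eqn_leq ilen]; rewrite xn.
  - move=> i; rewrite ltnS => ilen; rewrite ilen; case: (ltnP i n) => [ilt|nle].
      exact: dt.
    by have -> : i = n by [apply/eqP; rewrite eqn_leq ilen]; rewrite xn.
have zb : z <= b by rewrite /z ge_min lexx.
have zc : z <= c.
  by apply: ub_le_sup; [case: supS|split => //; rewrite zb (le_trans ac)].
have : z = b.
  move: zc; rewrite /z; case: (leP b (c + delta c / 2)) => // _.
  by rewrite gerDl leNgt divr_gt0.
by move=> <-.
Qed.

(** A partition fine for the minimum of both gauges has a sum close to both values. *)
Lemma HK_on_unique (a b : R) g v w : HK_on a b g v -> HK_on a b g w -> v = w.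
Proof.
move=> [ab Hv] [_ Hw]; apply/eqP; rewrite -subr_eq0 -normr_eq0 eq_le normr_ge0 andbT.
apply/ler_addgt0Pr => e e0; rewrite add0r.
have e20 : 0 < e / 2 by rewrite divr_gt0.
have [d1 [d10 H1]] := Hv _ e20; have [d2 [d20 H2]] := Hw _ e20.
have [|n [x [t [x0 xn xt dt]]]] := @cousin a b (fun x => Num.min (d1 x) (d2 x)) ab.
  by move=> x; rewrite lt_min d10 d20.
have := H1 n x t x0 xn xt; have := H2 n x t x0 xn xt.
move=> h2 h1.
have {}h1 : `|\sum_(i < n) g (t i) * (x i.+1 - x i) - v| < e / 2.
  apply: h1 => i /dt[]; rewrite /Num.min/=; case: ifPn; rewrite -?leNgt => ? ? ?; split; lra.
have {}h2 : `|\sum_(i < n) g (t i) * (x i.+1 - x i) - w| < e / 2.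
  apply: h2 => i /dt[]; rewrite /Num.min/=; case: ifPn; rewrite -?leNgt => ? ? ?; split; lra.
move: h1 h2; set s := (\sum_(i < n) _) => h1 h2.
rewrite (_ : v - w = (s - w) - (s - v)); last by lra.
by rewrite (le_trans (ler_normB _ _))//; lra.
Qed.

(** Since t lies between x and y, the errors e * (t - x) and e * (y - t) of the two first-order
    expansions at t add up to e * (y - x) exactly. Summed over a partition such errors telescope. *)
Lemma straddle (F : R -> R) (t l e : R) : 0 < e -> is_derive t (1 : R) F l ->
  exists2 d, 0 < d & forall x y, x <= t -> t <= y -> t - d < x -> y < t + d ->
   `|F y - F x - l * (y - x)| <= e * (y - x).
Proof.
move=> e0 [dF Fl].
have : h^-1 *: (F (h + t) - F t) @[h --> 0^'] --> l.
  rewrite (_ : (fun h => _) = (fun h => h^-1 *: ((F \o shift t) (h *: 1) - F t))); last first.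
    by apply/funext => h /=; rewrite [h *: 1]mulr1.
  by rewrite -Fl; exact: dF.
move=> /cvgrPdist_le /(_ _ e0).
rewrite near_withinE => /nbhs_ballP[d /= d0 H].
have {}H h : `|h| < d -> `|F (h + t) - F t - l * h| <= e * `|h|.
  have [->|h0] := eqVneq h 0.
    by rewrite add0r subrr mulr0 subrr normr0 mulr0.
  move=> hd; have := H h; rewrite /ball/= sub0r normrN => /(_ hd h0).
  rewrite -(ler_pM2r (_ : 0 < `|h|)) ?normr_gt0// -normrM mulrBl.
  by rewrite /GRing.scale/= mulrAC mulVf// mul1r distrC.
exists d => // x y xt ty dx dy.
have h1 := H (y - t); have h2 := H (x - t).
rewrite !subrK in h1 h2.
have {}h1 : `|F y - F t - l * (y - t)| <= e * (y - t).
  by move: h1; rewrite ger0_norm ?subr_ge0//; apply; lra.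
have {}h2 : `|F x - F t - l * (x - t)| <= e * (t - x).
  by move: h2; rewrite ler0_norm ?subr_le0// opprB; apply; lra.
rewrite (_ : _ - _ - _ = (F y - F t - l * (y - t)) - (F x - F t - l * (x - t))); last by ring.
by rewrite (le_trans (ler_normB _ _))//; lra.
Qed.

Lemma HK_on_derive (a b : R) (F g : R -> R) : a <= b ->
  (forall t, a <= t <= b -> is_derive t (1 : R) F (g t)) -> HK_on a b g (F b - F a).
Proof.
move=> ab dF; split => // e e0.
(* The summand 1 keeps the denominator positive when a = b and makes the total error strictly less
   than e. *)
have e'0 : 0 < e / (b - a + 1) by rewrite divr_gt0//; lra.
have : forall t, exists d, 0 < d /\ (a <= t <= b -> forall x y, x <= t -> t <= y -> t - d < x -> y < t + d ->
   `|F y - F x - g t * (y - x)| <= e / (b - a + 1) * (y - x)).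
  move=> t; have [tab|tab] := boolP (a <= t <= b).
    by have [d d0 H] := straddle e'0 (dF _ tab); exists d; split.
  by exists 1; split.
move=> /choice[delta Hd].
exists delta; split; first by move=> x; have [] := Hd x.
move=> n x t x0 xn xt dt.
have xle i j : (i <= j)%N -> (j <= n)%N -> x i <= x j.
  elim: j => [|j IH]; first by rewrite leqn0 => /eqP ->.
  rewrite leq_eqVlt => /predU1P[->//|]; rewrite ltnS => ij jn.
  rewrite (le_trans (IH ij (ltnW jn)))//.
  by have [] := xt j jn; exact: le_trans.
have tel : \sum_(i < n) (F (x i.+1) - F (x i)) = F b - F a.
  rewrite -(big_mkord xpredT (fun i => F (x i.+1) - F (x i))) telescope_sumr//.
  by rewrite x0 xn.
have telx : \sum_(i < n) (x i.+1 - x i) = b - a.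
  rewrite -(big_mkord xpredT (fun i => x i.+1 - x i)) telescope_sumr//.
  by rewrite x0 xn.
rewrite -tel -sumrB (le_lt_trans (ler_norm_sum _ _ _))//.
apply: (@le_lt_trans _ _ (\sum_(i < n) e / (b - a + 1) * (x i.+1 - x i))).
  apply: ler_sum => i _; rewrite distrC.
  have [ti1 ti2] := xt i (ltn_ord i); have [di1 di2] := dt i (ltn_ord i).
  have [_] := Hd (t i); apply => //.
  apply/andP; split.
    by rewrite -x0 (le_trans _ ti1)// xle// ltnW.
  by rewrite -xn (le_trans ti2)// xle.
rewrite -mulr_sumr telx -mulrA mulrC -ltr_pdivlMr// divff ?gt_eqF//.
by rewrite mulrC ltr_pdivrMr; lra.
Qed.

Lemma continuous_integrable_itv g (i : interval R) (a b : R) : continuous g ->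
  [set` i] `<=` `[a, b] -> mu.-integrable [set` i] (EFin \o g).
Proof.
move=> cg iab; apply: (@integrableS _ _ _ mu `[a, b]%classic) => //.
apply: continuous_compact_integrable; first exact: segment_compact.
exact: continuous_subspaceT.
Qed.

Lemma HK_on_continuous (a b : R) g : a <= b -> continuous g ->
  HK_on a b g (\int[mu]_(x in `]a, b]) g x).
Proof.
move=> ab cg.
(* The primitive starts at a - 1 so that it is differentiable from both sides at a as well. *)
pose F x := \int[mu]_(t in [set` Interval (BRight (a - 1)) (BRight x)]) g t.
have ig y : mu.-integrable [set` Interval (BRight (a - 1)) (BRight y)] (EFin \o g).
  by apply: (@continuous_integrable_itv _ _ (a - 1) y) => //; exact: subset_itv_oc_cc.
have -> : \int[mu]_(x in `]a, b]) g x = F b - F a.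
  by rewrite /F Rintegral_itvB// bnd_simp//; lra.
apply: HK_on_derive => // t /andP[at_ tb].
have [|||dF F'] := @continuous_FTC1 _ g (BRight (a - 1)) t (t + 1) _ (ig _).
- by rewrite ltrDl.
- by rewrite (@lte_fin R); lra.
- exact: cg.
by apply: DeriveDef; [exact: dF|rewrite -derive1E].
Qed.

(** [HKint] is a choice among the admissible values, so I must be shown both admissible and unique.
    Uniqueness compares two candidates on a single interval []- M, M]] that is large enough for
    both. *)
Lemma HKint_eq g I : continuous g ->
  (forall e : R, 0 < e -> exists M, forall a b, a <= - M -> M <= b -> a <= b ->
     `|\int[mu]_(x in `]a, b]) g x - I| < e) ->
  HKint g = I.
Proof.
move=> cg gI.
have HI : HK_R g I.
  split; first by move=> a b ab; eexists; exact: HK_on_continuous.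
  move=> e /gI[M HM]; exists M => a b v aM Mb Hv.
  have ab : a <= b by case: Hv.
  by rewrite (HK_on_unique Hv (HK_on_continuous ab cg)) HM.
have HJ : HK_R g (HKint g) by apply: (@xgetPex _ _ [set I | HK_R g I]); exists I.
case: HI => _ HI; case: HJ => _ HJ.
apply/eqP; rewrite -subr_eq0 -normr_eq0 eq_le normr_ge0 andbT.
apply/ler_addgt0Pr => e e0; rewrite add0r.
have e20 : 0 < e / 2 by rewrite divr_gt0.
have [M1 H1] := HI _ e20; have [M2 H2] := HJ _ e20.
pose M := `|M1| + `|M2|.
have M1M : M1 <= M by rewrite (le_trans (ler_norm _))// lerDl.
have M2M : M2 <= M by rewrite (le_trans (ler_norm _))// lerDr.
have M0 : 0 <= M by rewrite addr_ge0.
have MM : - M <= M by lra.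
have Hv := HK_on_continuous MM cg.
have h1 : _ := H1 _ _ _ _ _ Hv; have h2 := H2 _ _ _ _ _ Hv.
have {}h1 := h1 (_ : - M <= - M1) M1M; have {}h2 := h2 (_ : - M <= - M2) M2M.
move: h1 h2; rewrite !lerN2 => /(_ M1M) h1 /(_ M2M).
move: h1; set s := \int[mu]_(x in _) _ => h1 h2.
rewrite (_ : HKint g - I = (s - I) - (s - HKint g)); last by lra.
by rewrite (le_trans (ler_normB _ _))//; lra.
Qed.

End HK.

(** * Sine and cosine transforms of integrable functions *)

Section Fourier.
Context {R : realType}.
Local Notation mu := (@lebesgue_measure R).
Implicit Types (f g u h c : R -> R).

Lemma ge0_integral_bigcup_le (F : nat -> set R) f (M : \bar R) :
  (forall n, measurable (F n)) -> nondecreasing_seq F ->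
  measurable_fun setT f -> (forall x, 0 <= f x) ->
  (forall n, (\int[mu]_(x in F n) (f x)%:E <= M)%E) ->
  (\int[mu]_(x in \bigcup_n F n) (f x)%:E <= M)%E.
Proof.
move=> mF ndF mf f0 fM.
have cF : (\int[mu]_(x in F i) (f x)%:E @[i --> \oo] -->
    \int[mu]_(x in \bigcup_i F i) (f x)%:E)%E.
  apply: ge0_nondecreasing_set_cvg_integral => //.
  - by move=> i; apply/measurable_EFinP/measurable_funTS.
  - by move=> i x _; rewrite lee_fin.
by apply: (cvge_to_le cF); exact: nearW.
Qed.

Lemma ge0_integralT_le f (M : \bar R) : measurable_fun setT f ->
  (forall x, 0 <= f x) ->
  (forall n : nat, (\int[mu]_(x in `](- n%:R)%R, n%:R]) (f x)%:E <= M)%E) ->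
  (\int[mu]_x (f x)%:E <= M)%E.
Proof.
move=> mf f0 fM; rewrite -(bigcup_itvT false false).
apply: ge0_integral_bigcup_le => // n m nm.
by apply/subsetPset/subset_itv; rewrite leBSide/= ?lerN2 ler_nat.
Qed.

Lemma EFin_Rintegral (D : set R) f : measurable D -> mu.-integrable D (EFin \o f) ->
  (\int[mu]_(x in D) f x)%:E = (\int[mu]_(x in D) (f x)%:E)%E.
Proof. by move=> mD fi; rewrite /Rintegral fineK// integrable_fin_num. Qed.

Lemma integrable_scaleR (D : set R) f k : measurable D ->
  mu.-integrable D (EFin \o f) -> mu.-integrable D (EFin \o (fun x => k * f x)).
Proof. by move=> mD fi; have := @integrableZl _ _ _ mu D mD k _ fi. Qed.

Lemma integrable_bdM (D : set R) (k f : R -> R) M : measurable D ->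
  measurable_fun D k -> (forall x, `|k x| <= M) ->
  mu.-integrable D (EFin \o f) -> mu.-integrable D (EFin \o (fun x => k x * f x)).
Proof.
move=> mD mk kM fi.
have mf : measurable_fun D f by have /measurable_int/measurable_EFinP := fi.
apply: (@le_integrable _ _ _ mu D mD _ (fun x => (M%:E * (f x)%:E)%E)).
- by apply/measurable_EFinP; exact: measurable_funM.
- move=> x _ /=; rewrite lee_fin !normrM ler_wpM2r//.
  exact: le_trans (kM x) (ler_norm _).
- exact: integrableZl.
Qed.

Lemma norm_Rintegral_bdM (k f : R -> R) M :
  measurable_fun setT k -> (forall x, `|k x| <= M) ->
  mu.-integrable setT (EFin \o f) ->
  `|\int[mu]_x (k x * f x)| <= M * \int[mu]_x `|f x|.
Proof.
move=> mk kM fi.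
apply: (le_trans (le_normr_Rintegral _ _)) => //.
  exact: (integrable_bdM _ mk kM).
rewrite -RintegralZl//; last exact: integrable_norm fi.
apply: le_Rintegral => //.
- apply: (@integrable_norm _ _ _ mu _ (fun x => k x * f x)).
  exact: (integrable_bdM _ mk kM).
- have := @integrableZl _ _ _ mu setT measurableT M _ (integrable_norm fi).
  by [].
- by move=> x _; rewrite normrM ler_wpM2r.
Qed.

(** The real and imaginary parts of the transform are treated by one argument, for a continuous
    kernel c bounded by 1. *)
Definition trigint c f s := \int[mu]_x (c (s * x) * f x).

Section trigint.
Variable c : R -> R.
Hypothesis cc : continuous c.
Hypothesis c1 : forall x, `|c x| <= 1.

Lemma continuous_scale (s : R) : continuous (fun x : R => c (s * x)).
Proof.
move=> x; apply: (continuous_comp (f := fun y => s * y)); last exact: cc.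
by apply: cvgM; [exact: cvg_cst|exact: cvg_id].
Qed.

Lemma measurable_scale (s : R) : measurable_fun setT (fun x : R => c (s * x)).
Proof. apply: continuous_measurable_fun; exact: continuous_scale. Qed.

Lemma continuous_scaler (s : R) : continuous (fun x : R => c (x * s)).
Proof.
move=> x; apply: (@continuous_comp _ _ _ (fun y : R => y * s) c); last exact: cc.
by apply: cvgM; [exact: cvg_id|exact: cvg_cst].
Qed.

Lemma integrable_trig f s : mu.-integrable setT (EFin \o f) ->
  mu.-integrable setT (EFin \o (fun x => c (s * x) * f x)).
Proof.
by apply: integrable_bdM => //; first exact: measurable_scale.
Qed.

Lemma trigint_le f s : mu.-integrable setT (EFin \o f) ->
  `|trigint c f s| <= \int[mu]_x `|f x|.
Proof.
move=> fi; rewrite -[leRHS]mul1r; apply: norm_Rintegral_bdM => //.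
exact: measurable_scale.
Qed.

Lemma continuous_trigint f : mu.-integrable setT (EFin \o f) ->
  continuous (trigint c f).
Proof.
move=> fi s.
have fin := integrable_norm fi.
have H := @continuity_under_integral R _ _ mu (fun s x => c (s * x) * f x) setT
  measurableT (s - 1) (s + 1) _ _ (fun x => `|f x|) fin _.
apply: H.
- by move=> x _; exact: integrable_trig.
- apply: aeW => y _ x _; apply: cvgM; last exact: cvg_cst.
  exact: continuous_scaler.
- move=> x _; apply: aeW => y _ /=; rewrite normrM ler_piMl//.
- by rewrite inE/= in_itv/=; apply/andP; split; lra.
Qed.

Lemma measurable_trigint f : mu.-integrable setT (EFin \o f) ->
  measurable_fun setT (trigint c f).
Proof. by move=> fi; apply: continuous_measurable_fun; exact: continuous_trigint. Qed.

(** The multiplication formula, by Fubini: as |c| <= 1, the double integrand is dominated by |g s|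
    |f x|. *)
Lemma trigint_dual f g : mu.-integrable setT (EFin \o f) ->
  mu.-integrable setT (EFin \o g) ->
  \int[mu]_s (g s * trigint c f s) = \int[mu]_x (f x * trigint c g x).
Proof.
move=> fi gi.
have mf : measurable_fun setT f by have /measurable_int/measurable_EFinP := fi.
have mg : measurable_fun setT g by have /measurable_int/measurable_EFinP := gi.
pose F (z : R * R) : \bar R := (g z.1 * (c (z.1 * z.2) * f z.2))%:E.
have mc : measurable_fun setT (c : R -> R) by exact: continuous_measurable_fun.
have mF : measurable_fun setT F.
  apply/measurable_EFinP; apply: measurable_funM.
    exact: measurableT_comp mg measurable_fst.
  apply: measurable_funM; last exact: measurableT_comp mf measurable_snd.
  apply: (measurableT_comp mc).
  by apply: measurable_funM; [exact: measurable_fst|exact: measurable_snd].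
have fE := EFin_Rintegral measurableT (integrable_norm fi).
have iF : (mu \x mu)%E.-integrable setT F.
  apply/(integrable12ltyP mu mu mF).
  apply: (@le_lt_trans _ _ (\int[mu]_s ((\int[mu]_x `|f x|)%:E * `|g s|%:E))%E).
    apply: ge0_le_integral => //.
    - by move=> s _; apply: integral_ge0 => x _.
    - apply: (measurable_fun_fubini_tonelli_F (m2 := mu) (abse \o F)).
        exact: measurableT_comp.
      by move=> z; exact: abse_ge0.
    - apply/measurable_EFinP/measurable_funM => //.
      exact: measurableT_comp.
    - move=> s _.
      have -> : ((\int[mu]_x `|f x|)%:E * `|g s|%:E = \int[mu]_x (`|g s|%:E * `|f x|%:E))%E.
        by rewrite ge0_integralZl//; [rewrite muleC fE|apply/measurable_EFinP; exact: measurableT_comp].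
      apply: ge0_le_integral => //.
      + have mFs : measurable_fun setT (fun x => g s * (c (s * x) * f x)).
          by apply: measurable_funM => //; apply: measurable_funM => //; exact: measurable_scale.
        by apply: measurableT_comp => //; exact/measurable_EFinP.
      + by apply/measurable_EFinP; apply: measurable_funM => //; exact: measurableT_comp.
      + by move=> x _; rewrite /F/= lee_fin !normrM ler_wpM2l// ler_piMl.
  rewrite ge0_integralZl//.
  - have /integrableP[_ gy] := gi.
    by rewrite lte_mul_pinfty// lee_fin Rintegral_ge0.
  - by apply/measurable_EFinP/measurableT_comp.
  - by rewrite lee_fin Rintegral_ge0.
have H := Fubini iF.
rewrite /Rintegral; congr fine.
transitivity (\int[mu]_s \int[mu]_x F (s, x))%E.
  apply: eq_integral => s _.
  rewrite EFinM EFin_Rintegral//; last exact: integrable_trig.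
  by rewrite -integralZl//; exact: integrable_trig.
rewrite H; apply: eq_integral => x _.
rewrite EFinM EFin_Rintegral//; last exact: integrable_trig.
rewrite -integralZl//; last exact: integrable_trig.
by apply: eq_integral => s _; rewrite /F/= -EFinM (mulrC x s); congr EFin; ring.
Qed.

End trigint.

Lemma cos_norm1 (x : R) : `|cos x| <= 1.
Proof. by rewrite ler_norml cos_geN1 cos_le1. Qed.

Lemma sin_norm1 (x : R) : `|sin x| <= 1.
Proof. by rewrite ler_norml sin_geN1 sin_le1. Qed.

(** Both sides are Henstock-Kurzweil integrals of f over [a, b], so uniqueness identifies them. *)
Lemma Rintegral_derive (a b : R) (F f : R -> R) : a <= b -> continuous f ->
  (forall t, is_derive t (1 : R) F (f t)) ->
  \int[mu]_(x in `]a, b]) f x = F b - F a.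
Proof.
move=> ab cf dF; apply: (@HK_on_unique _ a b f).
  exact: HK_on_continuous.
by apply: HK_on_derive => // t _; exact: dF.
Qed.

Lemma is_derive_linear (k x : R) : is_derive x (1 : R) (fun s : R => k * s) k.
Proof.
have H := is_deriveZ k (is_derive_id x (1 : R)).
by apply: (is_derive_eq H); rewrite /GRing.scale/= mulr1.
Qed.

Lemma continuous_mull (k : R) : continuous (fun s : R => k * s).
Proof. by move=> x; apply: cvgM; [exact: cvg_cst|exact: cvg_id]. Qed.

Lemma continuous_expN (e : R) : continuous (fun s : R => expR (- e * s)).
Proof.
move=> x; apply: (continuous_comp (f := fun s => - e * s)); first exact: continuous_mull.
exact: continuous_expR.
Qed.

(** The Poisson kernel of the half-plane without its factor 1 / pi; it is the integral of exp(- e s)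
    cos(z s) over s > 0. *)
Definition poisson (e z : R) := e / (e ^+ 2 + z ^+ 2).

Lemma poisson_den (e z : R) : 0 < e -> 0 < e ^+ 2 + z ^+ 2.
Proof. by move=> e0; rewrite ltr_wpDr ?sqr_ge0// exprn_gt0. Qed.

Lemma poisson_ge0 (e z : R) : 0 < e -> 0 <= poisson e z.
Proof. by move=> e0; rewrite divr_ge0 ?ltW// poisson_den. Qed.

Lemma poisson_le (e z : R) : 0 < e -> poisson e z <= e^-1.
Proof.
move=> e0; rewrite /poisson ler_pdivrMr ?poisson_den//.
by rewrite mulrDr expr2 mulKf ?gt_eqF// lerDl mulr_ge0 ?sqr_ge0// invr_ge0 ltW.
Qed.

Lemma continuous_poisson (e : R) : 0 < e -> continuous (poisson e).
Proof.
move=> e0 y; apply: cvgM; first exact: cvg_cst.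
apply: cvgV; first by rewrite gt_eqF// poisson_den.
by apply: cvgD; [exact: cvg_cst|exact: exprn_continuous].
Qed.

Lemma continuous_poisson_sub (e x : R) : 0 < e -> continuous (fun y : R => poisson e (x - y)).
Proof.
move=> e0 y; apply: (@continuous_comp _ _ _ (fun y : R => x - y) (poisson e)).
  by apply: cvgB; [exact: cvg_cst|exact: cvg_id].
exact: continuous_poisson.
Qed.

(** What remains at the upper end n is at most exp(- e n) (|z| + e) / (e^2 + z^2), and the fraction
    is at most 2 / e. A bound uniform in z is what allows the error to be pulled out of integrals
    against |u|. *)
Lemma laplace_cos_cut (e z n : R) : 0 < e -> 0 <= n ->
  `|\int[mu]_(s in `]0, n]) (expR (- e * s) * cos (z * s)) - poisson e z| <=
  2 / e * expR (- e * n).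
Proof.
move=> e0 n0; have den := poisson_den z e0.
(* The antiderivative found by integrating by parts twice. As F 0 = - [poisson e z], the quantity to
   estimate is F n alone. *)
pose F (s : R) := (e ^+ 2 + z ^+ 2)^-1 * (expR (- e * s) * (z * sin (z * s) - e * cos (z * s))).
have dF : forall t, is_derive t (1 : R) F (expR (- e * t) * cos (z * t)).
  move=> t.
  have d1 : is_derive t (1 : R) (fun s : R => expR (- e * s)) (expR (- e * t) * - e).
    apply: (@is_derive1_comp _ expR (fun s => - e * s)); exact: is_derive_linear.
  have d2 : is_derive t (1 : R) (fun s : R => sin (z * s)) (cos (z * t) * z).
    apply: (@is_derive1_comp _ sin (fun s => z * s)); exact: is_derive_linear.
  have d3 : is_derive t (1 : R) (fun s : R => cos (z * s)) (- sin (z * t) * z).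
    apply: (@is_derive1_comp _ cos (fun s => z * s)); exact: is_derive_linear.
  have d4 := is_deriveB (is_deriveZ z d2) (is_deriveZ e d3).
  have d5 := is_deriveZ (e ^+ 2 + z ^+ 2)^-1 (is_deriveM d1 d4).
  apply: (is_derive_eq d5).
  change ((e ^+ 2 + z ^+ 2)^-1 * (expR (- e * t) * (z * (cos (z * t) * z) -
    e * (- sin (z * t) * z)) + (z * sin (z * t) - e * cos (z * t)) *
    (expR (- e * t) * - e)) = expR (- e * t) * cos (z * t)).
  have : e ^+ 2 + z ^+ 2 != 0 by rewrite gt_eqF.
  by move=> ?; field.
have cF : continuous (fun s => expR (- e * s) * cos (z * s)).
  move=> x; apply: cvgM; first exact: continuous_expN.
  exact: (continuous_scale (@continuous_cos R)).
rewrite (Rintegral_derive n0 cF dF).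
have -> : F 0 = - poisson e z.
  by rewrite /F !mulr0 expR0 sin0 cos0 /poisson mulr1 mulr0 add0r mul1r mulrN mulrC.
rewrite opprK addrK /F normrM normrM gtr0_norm ?invr_gt0//.
rewrite (gtr0_norm (expR_gt0 _)) mulrCA mulrC ler_wpM2r ?expR_ge0//.
rewrite mulrC ler_pdivrMr// (le_trans (ler_normB _ _))//.
rewrite !normrM (gtr0_norm e0).
have s1 := sin_norm1 (z * n); have c1 := cos_norm1 (z * n).
apply: (@le_trans _ _ (`|z| + e)).
  by apply: lerD; [rewrite ler_piMr|rewrite ler_piMr// ltW].
rewrite -(real_normK (num_real z)) mulrAC ler_pdivlMr//.
have := sqr_ge0 (e - `|z|); have := sqr_ge0 `|z|; have := sqr_ge0 e; have := normr_ge0 z.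
move: (`|z|) => w; nra.
Qed.

Lemma is_derive_atan_shift (e x t : R) : 0 < e ->
  is_derive t (1 : R) (fun y => atan (e^-1 * (y - x))) (poisson e (x - t)).
Proof.
move=> e0.
have d0 : is_derive t (1 : R) (fun y : R => e^-1 * (y - x)) e^-1.
  have H := is_deriveZ e^-1 (is_deriveB (is_derive_id t (1 : R)) (is_derive_cst x t (1:R))).
  by apply: (is_derive_eq H); rewrite /GRing.scale/= subr0 mulr1.
have H0 := @is_derive1_comp _ atan (fun y => e^-1 * (y - x)) t _ _ (is_derive1_atan _) d0.
apply: (is_derive_eq H0); rewrite /poisson.
have := poisson_den (x - t) e0.
move=> /gt_eqF/negbT H; have e0' : e != 0 by rewrite gt_eqF.
have H' : 1 + (e^-1 * (t - x)) ^+ 2 != 0.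
  by rewrite gt_eqF// ltr_pwDl// sqr_ge0.
rewrite (_ : 1 + _ = (e ^+ 2 + (x - t) ^+ 2) / e ^+ 2); last by field.
by field; rewrite H e0'.
Qed.

(** The antiderivative is an arctangent, whose increments never exceed pi. *)
Lemma poisson_integral (e x : R) : 0 < e ->
  (\int[mu]_y (poisson e (x - y))%:E <= pi%:E)%E.
Proof.
move=> e0; have cq := @continuous_poisson_sub e x e0.
apply: ge0_integralT_le; first exact: continuous_measurable_fun.
  by move=> y; exact: poisson_ge0.
move=> n; have nn : - n%:R <= n%:R :> R by rewrite lerNl (le_trans _ (ler0n _ n))// oppr_le0.
rewrite -EFin_Rintegral//; last first.
  by apply: (@continuous_integrable_itv _ _ _ (- n%:R) n%:R) => //; exact: subset_itv_oc_cc.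
rewrite (Rintegral_derive nn cq (fun t => is_derive_atan_shift x t e0)) lee_fin.
have := atan_ltpi2 (e^-1 * (n%:R - x)); have := atan_gtNpi2 (e^-1 * (- n%:R - x)).
lra.
Qed.

Lemma poissonN (e z : R) : poisson e (- z) = poisson e z.
Proof. by rewrite /poisson sqrrN. Qed.

Lemma integrable_Mbd (D : set R) (f k : R -> R) M : measurable D ->
  measurable_fun D k -> (forall x, `|k x| <= M) ->
  mu.-integrable D (EFin \o f) -> mu.-integrable D (EFin \o (fun x => f x * k x)).
Proof.
move=> mD mk kM fi; rewrite (_ : (fun x => f x * k x) = fun x => k x * f x).
  exact: (integrable_bdM _ mk kM).
by apply/funext => x; rewrite mulrC.
Qed.

Lemma trigint_cosN f s : trigint cos f (- s) = trigint cos f s.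
Proof. by apply: eq_Rintegral => x _; rewrite mulNr cosN. Qed.

Lemma trigint_sinN f s : mu.-integrable setT (EFin \o f) ->
  trigint sin f (- s) = - trigint sin f s.
Proof.
move=> fi; rewrite /trigint -[RHS]mulN1r -RintegralZl//.
  by apply: eq_Rintegral => x _; rewrite mulNr sinN mulN1r mulNr.
exact: (integrable_trig (@continuous_sin R) sin_norm1).
Qed.

(** The cut at n reduces integrability and the evaluation of the cosine transform to continuous
    functions on a compact interval; n tends to infinity only at the end. *)
Definition expcut (e n : R) : R -> R := (fun s => expR (- e * s)) \_ `]0, n].

Lemma integrable_expcut e n : mu.-integrable setT (EFin \o expcut e n).
Proof.
have moc : measurable (`]0, n]%classic : set R) by exact: measurable_itv.
rewrite /expcut -restrict_EFin.
apply: (@integrable_mkcond _ _ _ mu `]0, n]%classic (EFin \o (fun s => expR (- e * s))) moc).1.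
apply: (@continuous_integrable_itv _ _ _ 0 n); last exact: subset_itv_oc_cc.
exact: continuous_expN.
Qed.

Lemma Rintegral_expcut e n k :
  \int[mu]_x (expcut e n x * k x) = \int[mu]_(x in `]0, n]) (expR (- e * x) * k x).
Proof.
rewrite [RHS]Rintegral_mkcond; apply: eq_Rintegral => x _.
by rewrite /expcut !patchE; case: ifP => // _; rewrite mul0r.
Qed.

(** * The Plancherel inequality for functions both integrable and square integrable *)

Section plancherel.
Variable u : R -> R.
Hypothesis iu : mu.-integrable setT (EFin \o u).
Hypothesis iu2 : mu.-integrable setT (EFin \o (fun x => u x ^+ 2)).
Let N := \int[mu]_x `|u x|.
Let U := \int[mu]_x (u x ^+ 2).
Let C := trigint cos u.
Let S := trigint sin u.
Let P s := C s ^+ 2 + S s ^+ 2.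

Let mu_ : measurable_fun setT u.
Proof. by have /measurable_int/measurable_EFinP := iu. Qed.

Let N0 : 0 <= N. Proof. by apply: Rintegral_ge0. Qed.

Let cC : continuous C.
Proof. exact: (continuous_trigint (@continuous_cos R) cos_norm1). Qed.

Let cS : continuous S.
Proof. exact: (continuous_trigint (@continuous_sin R) sin_norm1). Qed.

Let mC : measurable_fun setT C. Proof. exact: continuous_measurable_fun. Qed.
Let mS : measurable_fun setT S. Proof. exact: continuous_measurable_fun. Qed.
Let CN s : `|C s| <= N.
Proof. exact: (trigint_le (@continuous_cos R) cos_norm1). Qed.
Let SN s : `|S s| <= N.
Proof. exact: (trigint_le (@continuous_sin R) sin_norm1). Qed.

Let cP : continuous P.
Proof.
move=> s; apply: cvgD.
  by apply: (@continuous_comp _ _ _ C (fun w : R => w ^+ 2)); [exact: cC|exact: exprn_continuous].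
by apply: (@continuous_comp _ _ _ S (fun w : R => w ^+ 2)); [exact: cS|exact: exprn_continuous].
Qed.

Let P0 s : 0 <= P s. Proof. by rewrite addr_ge0// sqr_ge0. Qed.

(* Damping by exp(- e s) on ]0, n] turns the integral of P into a quadratic form in
   u whose kernel is the cosine transform of the damping factor; up to the error
   eta, this kernel is the Poisson kernel, of total mass pi. *)
Section damped.
Variables e n : R.
Hypothesis e0 : 0 < e.
Hypothesis n0 : 0 <= n.
Let h := expcut e n.
Let ih : mu.-integrable setT (EFin \o h) := integrable_expcut e n.
Let K z := trigint cos h z.
Let Ch s := C s * h s.
Let Sh s := S s * h s.
Let iCh : mu.-integrable setT (EFin \o Ch).
Proof. exact: (integrable_bdM measurableT mC CN). Qed.
Let iSh : mu.-integrable setT (EFin \o Sh).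
Proof. exact: (integrable_bdM measurableT mS SN). Qed.
Let B x := trigint cos Ch x + trigint sin Sh x.

(** In each of the squares C^2 and S^2 the multiplication formula moves one factor back onto u. *)
Let damped_dual :
  \int[mu]_(s in `]0, n]) (expR (- e * s) * P s) = \int[mu]_x (u x * B x).
Proof.
rewrite -Rintegral_expcut.
transitivity (\int[mu]_s (Ch s * C s) + \int[mu]_s (Sh s * S s)).
  rewrite -RintegralD//; first last.
  - exact: (integrable_Mbd _ mS SN).
  - exact: (integrable_Mbd _ mC CN).
  by apply: eq_Rintegral => s _; rewrite /Ch /Sh /P -/h; ring.
rewrite (trigint_dual (@continuous_cos R) cos_norm1 iu iCh).
rewrite (trigint_dual (@continuous_sin R) sin_norm1 iu iSh).
rewrite -RintegralD//.
- by apply: eq_Rintegral => x _; rewrite -mulrDr.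
- apply: (integrable_Mbd _ _ (fun x => trigint_le (@continuous_cos R) cos_norm1 x iCh)) => //.
  exact: (measurable_trigint (@continuous_cos R) cos_norm1).
- apply: (integrable_Mbd _ _ (fun x => trigint_le (@continuous_sin R) sin_norm1 x iSh)) => //.
  exact: (measurable_trigint (@continuous_sin R) sin_norm1).
Qed.

(** A second use of the multiplication formula, after which cos(x s) cos(y s) + sin(x s) sin(y s) =
    cos((x - y) s) turns B into the convolution of u with K. *)
Let BE x : B x = \int[mu]_y (u y * K (x - y)).
Proof.
have icx : mu.-integrable setT (EFin \o (fun s => cos (x * s) * h s)).
  exact: (integrable_trig (@continuous_cos R) cos_norm1).
have isx : mu.-integrable setT (EFin \o (fun s => sin (x * s) * h s)).
  exact: (integrable_trig (@continuous_sin R) sin_norm1).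
have -> : B x = \int[mu]_s ((cos (x * s) * h s) * C s) + \int[mu]_s ((sin (x * s) * h s) * S s).
  by rewrite /B /trigint; congr (_ + _); apply: eq_Rintegral => s _;
    rewrite /Ch /Sh; ring.
rewrite (trigint_dual (@continuous_cos R) cos_norm1 iu icx).
rewrite (trigint_dual (@continuous_sin R) sin_norm1 iu isx).
rewrite -RintegralD//; first last.
- apply: (integrable_Mbd _ _ (fun y => trigint_le (@continuous_sin R) sin_norm1 y isx)) => //.
  exact: (measurable_trigint (@continuous_sin R) sin_norm1).
- apply: (integrable_Mbd _ _ (fun y => trigint_le (@continuous_cos R) cos_norm1 y icx)) => //.
  exact: (measurable_trigint (@continuous_cos R) cos_norm1).
apply: eq_Rintegral => y _; rewrite -mulrDr; congr (_ * _).
rewrite /K /trigint -RintegralD//; first last.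
- exact: (integrable_trig (@continuous_sin R) sin_norm1).
- exact: (integrable_trig (@continuous_cos R) cos_norm1).
by apply: eq_Rintegral => s _; rewrite mulrBl cosB; ring.
Qed.

Let eta := 2 / e * expR (- e * n).

Let K_le z : `|K z| <= poisson e z + eta.
Proof.
have := laplace_cos_cut z e0 n0; rewrite -Rintegral_expcut -/h.
rewrite (_ : \int[mu]_x _ = K z); last first.
  by rewrite /K /trigint; apply: eq_Rintegral => x _; rewrite mulrC.
move=> H; rewrite -(ger0_norm (poisson_ge0 z e0)).
rewrite -{1}(subrK (poisson e z) (K z)) addrC (le_trans (ler_normD _ _))//.
by rewrite lerD2l.
Qed.

Let eta0 : 0 <= eta.
Proof. by rewrite mulr_ge0 ?expR_ge0// divr_ge0// ltW. Qed.

Let q_norm x y : `|poisson e (x - y)| <= e^-1.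
Proof. by rewrite ger0_norm ?poisson_ge0// poisson_le. Qed.

Let mq (x : R) : measurable_fun setT (fun y : R => poisson e (x - y)).
Proof. by apply: continuous_measurable_fun; exact: continuous_poisson_sub. Qed.

Let iuq x : mu.-integrable setT (EFin \o (fun y => `|u y| * poisson e (x - y))).
Proof. exact: (integrable_Mbd measurableT (mq x) (q_norm x) (integrable_norm iu)). Qed.

Let B_le x : `|B x| <= \int[mu]_y (`|u y| * poisson e (x - y)) + eta * N.
Proof.
have iuK : mu.-integrable setT (EFin \o (fun y => u y * K (x - y))).
  apply: (integrable_Mbd _ _ (fun y => trigint_le (@continuous_cos R) cos_norm1 (x - y) ih)) => //.
  apply: continuous_measurable_fun => y.
  apply: (@continuous_comp _ _ _ (fun y : R => x - y) K).
    by apply: cvgB; [exact: cvg_cst|exact: cvg_id].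
  exact: (continuous_trigint (@continuous_cos R) cos_norm1).
have ieu : mu.-integrable setT (EFin \o (fun y => eta * `|u y|)).
  exact: (integrable_scaleR _ _ (integrable_norm iu)).
rewrite BE (le_trans (le_normr_Rintegral _ _))//.
rewrite /N -RintegralZl//; last exact: (integrable_norm iu).
rewrite -RintegralD//.
apply: le_Rintegral => //.
- exact: (@integrable_norm _ _ _ mu _ (fun y => u y * K (x - y))).
- exact: (integrableD _ (iuq x) ieu).
move=> y _; rewrite normrM [eta * _]mulrC -mulrDr ler_wpM2l//.
Qed.

Let mu1 : measurable_fun setT (fun z : R * R => u z.1).
Proof. exact: measurableT_comp mu_ measurable_fst. Qed.
Let mu2 : measurable_fun setT (fun z : R * R => u z.2).
Proof. exact: measurableT_comp mu_ measurable_snd. Qed.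
Let mq2 : measurable_fun setT (fun z : R * R => poisson e (z.1 - z.2)).
Proof.
apply: (@measurableT_comp _ _ _ _ _ _ (poisson e) _ (fun z : R * R => z.1 - z.2)).
  by apply: continuous_measurable_fun; exact: continuous_poisson.
by apply: measurable_funB; [exact: measurable_fst|exact: measurable_snd].
Qed.

Let G (z : R * R) : \bar R := (`|u z.1| * (`|u z.2| * poisson e (z.1 - z.2)))%:E.
Let G1 (z : R * R) : \bar R := (2^-1 * u z.1 ^+ 2 * poisson e (z.1 - z.2))%:E.
Let G2 (z : R * R) : \bar R := (2^-1 * u z.2 ^+ 2 * poisson e (z.1 - z.2))%:E.

Let mG : measurable_fun setT G.
Proof.
apply/measurable_EFinP/measurable_funM; first exact: measurableT_comp.
by apply: measurable_funM => //; exact: measurableT_comp.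
Qed.
Let mG1 : measurable_fun setT G1.
Proof.
apply/measurable_EFinP/measurable_funM => //.
by apply: measurable_funM => //; exact: measurable_funX.
Qed.
Let mG2 : measurable_fun setT G2.
Proof.
apply/measurable_EFinP/measurable_funM => //.
by apply: measurable_funM => //; exact: measurable_funX.
Qed.
Let G0 z : (0 <= G z)%E.
Proof. by rewrite lee_fin; do 2 (apply: mulr_ge0 => //); exact: poisson_ge0. Qed.
Let G10 z : (0 <= G1 z)%E.
Proof. by rewrite lee_fin; apply: mulr_ge0; [rewrite mulr_ge0 ?sqr_ge0|exact: poisson_ge0]. Qed.
Let G20 z : (0 <= G2 z)%E.
Proof. by rewrite lee_fin; apply: mulr_ge0; [rewrite mulr_ge0 ?sqr_ge0|exact: poisson_ge0]. Qed.

(* Schur test: |u x u y| <= (u x ^ 2 + u y ^ 2) / 2. *)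
Let half_sq (g : R -> R -> R) :
  (forall x y, 0 <= g x y) -> (forall x, measurable_fun setT (g x)) ->
  (forall x, (\int[mu]_y (g x y)%:E <= pi%:E)%E) ->
  measurable_fun setT (fun x => \int[mu]_y (2^-1 * u x ^+ 2 * g x y)%:E)%E ->
  (\int[mu]_x \int[mu]_y (2^-1 * u x ^+ 2 * g x y)%:E <= (pi / 2 * U)%:E)%E.
Proof.
move=> g0 mg gpi mI.
have iu2' : mu.-integrable setT (EFin \o (fun x => pi / 2 * u x ^+ 2)).
  exact: (integrable_scaleR _ _ iu2).
rewrite -RintegralZl// EFin_Rintegral//.
apply: ge0_le_integral => //.
- move=> x _; apply: integral_ge0 => y _.
  by rewrite lee_fin; apply: mulr_ge0; [rewrite mulr_ge0 ?sqr_ge0|exact: g0].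
- by have /measurable_int := iu2'.
move=> x _.
have -> : (\int[mu]_y (2^-1 * u x ^+ 2 * g x y)%:E =
    (2^-1 * u x ^+ 2)%:E * \int[mu]_y (g x y)%:E)%E.
  under eq_integral do rewrite EFinM.
  rewrite ge0_integralZl//; do ?[by apply/measurable_EFinP; exact: mg | by move=> y _; rewrite lee_fin
    | by rewrite lee_fin mulr_ge0 ?sqr_ge0].
rewrite (le_trans (lee_wpmul2l _ (gpi x)))//.
  by rewrite lee_fin mulr_ge0 ?sqr_ge0.
suff -> : pi / 2 * u x ^+ 2 = 2^-1 * u x ^+ 2 * pi by [].
by ring.
Qed.

(** By Tonelli the integration order can be chosen separately for the two halves: y innermost for
    G1, x innermost for G2, so that each time the inner integral is the mass of the even Poisson
    kernel. *)
Let G_int : (\int[mu]_x \int[mu]_y G (x, y) <= (pi * U)%:E)%E.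
Proof.
rewrite -(fubini_tonelli1 (m1 := mu) (m2 := mu) G)//.
apply: (@le_trans _ _ (\int[mu \x mu]_z (G1 z + G2 z))%E).
  apply: ge0_le_integral => //.
  - exact: emeasurable_funD.
  move=> z _; rewrite lee_fin.
  have q0 := poisson_ge0 (z.1 - z.2) e0.
  rewrite mulrA -mulrDl ler_wpM2r// -(real_normK (num_real (u z.1))) -(real_normK (num_real (u z.2))).
  have := sqr_ge0 (`|u z.1| - `|u z.2|); move: (`|u z.1|) (`|u z.2|) => a b; nra.
rewrite ge0_integralD//.
have -> : (pi * U)%:E = ((pi / 2 * U)%:E + (pi / 2 * U)%:E)%E.
  by rewrite -EFinD; congr EFin; field.
apply: leeD.
  rewrite (fubini_tonelli1 (m1 := mu) (m2 := mu) G1)//.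
  apply: (half_sq (g := fun x y => poisson e (x - y))) => //.
  - by move=> x y; exact: poisson_ge0.
  - by move=> x; exact: poisson_integral.
  - exact: (measurable_fun_fubini_tonelli_F (m2 := mu) G1).
rewrite (fubini_tonelli2 (m1 := mu) (m2 := mu) G2)//.
apply: (half_sq (g := fun y x => poisson e (x - y))) => //.
- by move=> x y; exact: poisson_ge0.
- move=> x; rewrite (_ : (fun y => _) = fun y => poisson e (x - y)) => //.
  by apply/funext => y; rewrite -opprB poissonN.
- move=> x; under eq_integral do rewrite -opprB poissonN.
  exact: poisson_integral.
- exact: (measurable_fun_fubini_tonelli_G (m1 := mu) G2).
Qed.

Let B_bd x : `|B x| <= \int[mu]_s `|Ch s| + \int[mu]_s `|Sh s|.
Proof.
rewrite (le_trans (ler_normD _ _))// lerD//.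
  exact: (trigint_le (@continuous_cos R) cos_norm1).
exact: (trigint_le (@continuous_sin R) sin_norm1).
Qed.

Let mB : measurable_fun setT B.
Proof.
apply: measurable_funD.
  exact: (measurable_trigint (@continuous_cos R) cos_norm1).
exact: (measurable_trigint (@continuous_sin R) sin_norm1).
Qed.

Lemma damped_le :
  \int[mu]_(s in `]0, n]) (expR (- e * s) * P s) <= pi * U + eta * N ^+ 2.
Proof.
rewrite damped_dual.
have iuB : mu.-integrable setT (EFin \o (fun x => u x * B x)).
  exact: (integrable_Mbd _ mB B_bd).
apply: (le_trans (ler_norm _)); apply: (le_trans (le_normr_Rintegral _ _)) => //.
rewrite -lee_fin EFin_Rintegral//; last exact: (@integrable_norm _ _ _ mu _ (fun y => u y * B y)).
have iNu : mu.-integrable setT (EFin \o (fun x => eta * N * `|u x|)).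
  exact: (integrable_scaleR _ _ (integrable_norm iu)).
have mGx : measurable_fun setT (fun x => \int[mu]_y G (x, y))%E.
  exact: (measurable_fun_fubini_tonelli_F (m2 := mu) G).
apply: (@le_trans _ _ (\int[mu]_x (\int[mu]_y G (x, y) + (eta * N * `|u x|)%:E))%E).
  apply: ge0_le_integral => //.
  - by apply/measurable_EFinP/measurableT_comp => //; exact: measurable_funM.
  - by apply: emeasurable_funD => //; have /measurable_int := iNu.
  move=> x _.
  have -> : (\int[mu]_y G (x, y) = (`|u x| * \int[mu]_y (`|u y| * poisson e (x - y)))%:E)%E.
    rewrite EFinM EFin_Rintegral// -ge0_integralZl//.
    - by have /measurable_int := iuq x.
    - by move=> y _; rewrite lee_fin mulr_ge0// poisson_ge0.
  rewrite -EFinD lee_fin normrM (mulrC (eta * N)) -mulrDr ler_wpM2l//.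
rewrite ge0_integralD//; first last.
- by have /measurable_int := iNu.
- by move=> x _; rewrite lee_fin; apply: mulr_ge0 => //; apply: mulr_ge0.
- by move=> x _; exact: integral_ge0.
rewrite EFinD leeD//.
rewrite -EFin_Rintegral// RintegralZl//; last exact: (integrable_norm iu).
by rewrite lee_fin -/N expr2 mulrA.
Qed.

End damped.

(** The order of the limits matters, because the error term carries a factor 2 / e: the cut m goes
    to infinity with e fixed, and only then does e go to 0. *)
Let half_le (n : R) : 0 <= n -> \int[mu]_(s in `]0, n]) P s <= pi * U.
Proof.
move=> n0; set I := \int[mu]_(s in _) _.
have moc (m : R) : measurable (`]0, m]%classic : set R) by exact: measurable_itv.
have iP m : mu.-integrable `]0, m] (EFin \o P).
  by apply: (@continuous_integrable_itv _ _ _ 0 m) => //; exact: subset_itv_oc_cc.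
have I0 : 0 <= I by apply: Rintegral_ge0 => // x _; exact: P0.
have U0 : 0 <= U by apply: Rintegral_ge0 => // x _; exact: sqr_ge0.
have ceP (e : R) : continuous (fun s => expR (- e * s) * P s).
  by move=> x; apply: cvgM; [exact: continuous_expN|exact: cP].
have step1 (e m : R) : 0 < e -> n <= m ->
    expR (- e * n) * I <= pi * U + 2 / e * expR (- e * m) * N ^+ 2.
  move=> e0 nm; apply: le_trans (damped_le e0 (le_trans n0 nm)).
  have ieP k : mu.-integrable `]0, k] (EFin \o (fun s => expR (- e * s) * P s)).
    by apply: (@continuous_integrable_itv _ _ _ 0 k) => //; exact: subset_itv_oc_cc.
  apply: (@le_trans _ _ (\int[mu]_(s in `]0, n]) (expR (- e * s) * P s))).
    rewrite -RintegralZl//; apply: le_Rintegral => //.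
      exact: (integrable_scaleR _ _ (iP n)).
    move=> s /=; rewrite in_itv/= => /andP[s0 sn]; rewrite ler_wpM2r//.
    by rewrite ler_expR !mulNr lerN2 ler_wpM2l// ltW.
  rewrite -lee_fin !EFin_Rintegral//; apply: ge0_subset_integral => //.
  - by apply/measurable_EFinP; apply: measurable_funTS; exact: continuous_measurable_fun.
  - by move=> x _; rewrite lee_fin mulr_ge0// expR_ge0.
  - by apply: subset_itvl; rewrite bnd_simp.
have step2 (e : R) : 0 < e -> expR (- e * n) * I <= pi * U.
  move=> e0; apply/ler_addgt0Pr => d d0.
  pose k := 2 / e * N ^+ 2.
  have k0 : 0 <= k by rewrite mulr_ge0 ?sqr_ge0// divr_ge0// ltW.
  (* Chosen so that exp(e m) >= 1 + e m makes d * exp(e m) at least k, that is, the error at most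
     d. *)
  pose m := n + k / (d * e).
  have kde0 : 0 <= k / (d * e) by rewrite divr_ge0// ltW// mulr_gt0.
  apply: (le_trans (step1 e m e0 _)); first by rewrite lerDl.
  rewrite lerD2l mulrAC -/k.
  have := expR_ge1Dx (e * m); have := expR_gt0 (e * m).
  rewrite mulNr expRN => E0 E1; rewrite ler_pdivrMr//.
  apply: (le_trans _ (ler_wpM2l (ltW d0) E1)).
  have -> : d * (1 + e * m) = d + d * e * n + k.
    by rewrite /m; field; rewrite !gt_eqF.
  have : 0 <= d * e * n by rewrite !mulr_ge0// ltW.
  lra.
apply/ler_addgt0Pr => d d0.
(* Since exp(- e n) >= 1 - e n, the damping costs at most e n I, which this e keeps below d. *)
pose e := d / (n * I + 1).
have nI : 0 <= n * I by exact: mulr_ge0.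
have nI1 : 0 < n * I + 1 by lra.
have e0 : 0 < e by rewrite divr_gt0.
have := step2 e e0; have := expR_ge1Dx (- e * n) => E1 E2.
have : (1 + - e * n) * I <= pi * U by apply: le_trans E2; exact: ler_wpM2r.
have -> : (1 + - e * n) * I = I - d * (n * I / (n * I + 1)).
  by rewrite /e; field; rewrite gt_eqF.
have : n * I / (n * I + 1) <= 1 by rewrite ler_pdivrMr//; lra.
move=> H1 H2.
have := ler_wpM2l (ltW d0) H1; lra.
Qed.

(** The cosine transform is even and the sine transform odd, so the sum of squares is even and the
    half-line bound pi * U doubles. *)
Lemma plancherel_trigint :
  (\int[mu]_s (trigint cos u s ^+ 2 + trigint sin u s ^+ 2)%:E <= (2 * pi * U)%:E)%E.
Proof.
rewrite -/C -/S (@ge0_symfun_integralT R P)//; last first.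
  move=> s /=; rewrite /P /C /S trigint_cosN trigint_sinN// sqrrN//.
rewrite -mulrA EFinM lee_pmul2l//.
have mP : measurable_fun setT P by exact: continuous_measurable_fun.
rewrite -set_itvcy -integral_itv_obnd_cbnd//; last first.
  by apply/measurable_EFinP/measurable_funTS.
rewrite itv_bndy_bigcup_BRight.
apply: ge0_integral_bigcup_le => //.
  move=> m k mk; apply/subsetPset/subset_itvl.
  by rewrite bnd_simp lerD2l ler_nat.
move=> m; rewrite -EFin_Rintegral//.
  by rewrite lee_fin add0r half_le.
by apply: (@continuous_integrable_itv _ _ _ 0 (0 + m%:R)) => //; exact: subset_itv_oc_cc.
Qed.

End plancherel.

End Fourier.

(** * Conditionally convergent integrals over the line *)

Section limint.
Context {R : realType}.
Local Notation mu := (@lebesgue_measure R).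
Implicit Types (f g h c d : R -> R).

(** The limit clause of [HK_R] with Lebesgue integrals over bounded intervals. It also makes sense
    for integrands built from u_n - phi, which need not be continuous. *)
Definition lim_int g (I : R) := forall e : R, 0 < e -> exists M, forall a b,
  a <= - M -> M <= b -> a <= b -> `|\int[mu]_(x in `]a, b]) g x - I| < e.

Lemma lim_int_HK g I : continuous g -> lim_int g I -> HKint g = I.
Proof. exact: HKint_eq. Qed.

Lemma lim_int_integrable g : mu.-integrable setT (EFin \o g) ->
  lim_int g (\int[mu]_x g x).
Proof.
move=> ig e e0.
have ing := integrable_norm ig.
have iS (k : R -> R) (D : set R) : measurable D -> mu.-integrable setT (EFin \o k) ->
    mu.-integrable D (EFin \o k).
  by move=> mD; exact: integrableS.
have cN : ((\int[mu]_(x in `](- n%:R)%R, n%:R]) (`|g x|)%:E) @[n --> \oo] -->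
    \int[mu]_x (`|g x|)%:E)%E.
  rewrite -(bigcup_itvT false false).
  apply: ge0_nondecreasing_set_cvg_integral => //.
  - by move=> n m nm; apply/subsetPset/subset_itv; rewrite leBSide/= ?lerN2 ler_nat.
  - by move=> i; apply: (measurable_int mu); exact: iS ing.
have cN' : \int[mu]_(x in `](- n%:R)%R, n%:R]) `|g x| @[n --> \oo] --> \int[mu]_x `|g x|.
  by move: cN; rewrite -(EFin_Rintegral measurableT ing) => /fine_cvg.
have /cvgrPdist_lt /(_ _ e0) [N _ HN] := cN'.
exists N%:R => a b aN Nb ab.
pose D : set R := `]a, b]%classic.
have mD : measurable D by exact: measurable_itv.
have mDC : measurable (~` D) by exact: measurableC.
have split_int (k : R -> R) : mu.-integrable setT (EFin \o k) ->
    \int[mu]_x k x = \int[mu]_(x in D) k x + \int[mu]_(x in ~` D) k x.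
  move=> ik; rewrite -Rintegral_setU ?setUv//.
  by apply/disj_setPS => x [].
rewrite (split_int _ ig) distrC addrC addKr.
rewrite (le_lt_trans (le_normr_Rintegral _ _))//; first exact: iS ig.
have := HN N (leqnn N); rewrite /= (split_int _ ing) => HH.
have le1 : \int[mu]_(x in `](- N%:R)%R, N%:R]) `|g x| <= \int[mu]_(x in D) `|g x|.
  rewrite -lee_fin !EFin_Rintegral//; try exact: iS ing.
  apply: ge0_subset_integral => //.
  - by apply: (measurable_int mu); exact: iS ing.
  - by apply: subset_itv; rewrite bnd_simp.
have HH' := le_lt_trans (ler_norm _) HH.
by apply: le_lt_trans HH'; rewrite addrAC lerDr subr_ge0.
Qed.

Lemma lim_intB g h I J : lim_int g I -> lim_int h J ->
  (forall a b, mu.-integrable `]a, b] (EFin \o g)) ->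
  (forall a b, mu.-integrable `]a, b] (EFin \o h)) ->
  lim_int (fun x => g x - h x) (I - J).
Proof.
move=> gI hJ ig ih e e0.
have e20 : 0 < e / 2 by rewrite divr_gt0.
have [M1 H1] := gI _ e20; have [M2 H2] := hJ _ e20.
exists (`|M1| + `|M2|) => a b aM Mb ab.
have := ler_norm M1; have := ler_norm M2; have := normr_ge0 M1; have := normr_ge0 M2.
move=> ? ? ? ?.
have h1 := H1 a b (_ : a <= - M1) (_ : M1 <= b) ab.
have {}h1 : `|\int[mu]_(x in `]a, b]) g x - I| < e / 2 by apply: h1; lra.
have {}h2 : `|\int[mu]_(x in `]a, b]) h x - J| < e / 2 by apply: (H2 a b) => //; lra.
rewrite RintegralB//.
rewrite (_ : _ - _ - _ = (\int[mu]_(x in `]a, b]) g x - I) - (\int[mu]_(x in `]a, b]) h x - J)); last by lra.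
by rewrite (le_lt_trans (ler_normB _ _))//; lra.
Qed.

Lemma lim_int_cvg g I : lim_int g I ->
  \int[mu]_(x in `](- m%:R)%R, m%:R]) g x @[m --> \oo] --> I.
Proof.
move=> gI; apply/cvgrPdist_lt => e /gI[M HM].
exists (Num.bound `|M|) => // m /= Mm; rewrite distrC.
have Mm' : `|M| <= m%:R.
  by rewrite (le_trans (ltW (archi_boundP (normr_ge0 M))))// ler_nat.
have := ler_norm M; have := normr_ge0 M => ? ?.
by apply: HM; lra.
Qed.

End limint.

(** * Integration by parts and the cosine and sine integrals of phi *)

Section parts.
Context {R : realType}.
Local Notation mu := (@lebesgue_measure R).
Variable phi : R -> R.
Hypothesis bv0 : BV0 phi.
Hypothesis acl : AC_loc phi.

Lemma AC_loc_continuous : continuous phi.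
Proof.
move=> x; apply/cvgrPdist_lt => e e0.
have x1 : x - 1 <= x + 1 by lra.
have [d d0 H] := abs_cont_unif (acl x1) e0.
near=> y.
have yd : `|x - y| < d by near: y; exact: (@cvgr_dist_lt _ R^o).
have y1 : `|x - y| < 1 by near: y; exact: (@cvgr_dist_lt _ R^o).
move: y1; rewrite ltr_norml => /andP[? ?].
have [xy|yx] := leP x y.
  by rewrite distrC; apply: H; try lra; move: yd; rewrite ler0_norm ?subr_le0//; lra.
by apply: H; try lra; move: yd; rewrite gtr0_norm ?subr_gt0//; lra.
Unshelve. all: by end_near. Qed.

(** One M serves both purposes: far to the right phi is smaller than any e, and coming back to x
    changes it by at most the total variation. *)
Lemma BV0_bound : exists2 M : R, 0 <= M &
  (forall a b, a <= b -> bounded_variation a b phi /\ fine (total_variation a b phi) <= M) /\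
  forall x, `|phi x| <= M.
Proof.
case: bv0 => -[M HM] [phiy _].
have M0 : 0 <= M.
  have [_] := HM 0 0 (lexx _); rewrite total_variationxx lee_fin//.
have HM' a b : a <= b -> bounded_variation a b phi /\ fine (total_variation a b phi) <= M.
  move=> /[dup] ab /HM[bv tv]; split => //.
  by rewrite -lee_fin fineK//; exact/bounded_variationP.
exists M => //; split => // x.
apply/ler_addgt0Pr => e e0.
have [y [xy ye]] : exists y, x <= y /\ `|phi y| < e.
  apply: (@filter_ex _ (pinfty_nbhs R)).
  near=> y; split; first by near: y; apply: nbhs_pinfty_ge; exact: num_real.
  near: y; have /cvgrPdist_lt /(_ _ e0) := phiy.
  by apply: filterS => y; rewrite sub0r normrN.
have [bv tv] := HM' _ _ xy.
have := tv_ge_norm bv (lexx x) xy (lexx y).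
have := ler_normB (phi y) (phi y - phi x).
rewrite opprB addrC subrK; lra.
Unshelve. all: by end_near. Qed.

Lemma integrable_derive1_BV0 : mu.-integrable setT (EFin \o phi^`()%classic).
Proof.
have [M M0 [bvM _]] := BV0_bound.
have cphi := AC_loc_continuous.
have md := measurable_derive1 cphi.
apply/integrableP; split; first exact/measurable_EFinP.
apply: (@le_lt_trans _ _ (3 * M)%:E); last exact: ltry.
apply: (@ge0_integralT_le _ (fun x => `|phi^`()%classic x|)) => //.
  exact: measurableT_comp.
move=> n; have [n0|n0] := leP n%:R (- n%:R : R).
  by rewrite set_itv_ge ?bnd_simp -?leNgt// integral_set0 lee_fin mulr_ge0.
have [bv tv] := bvM _ _ (ltW n0).
have [i1 _ b1 _] := ftc_abs_cont n0 cphi bv (acl (ltW n0)).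
rewrite -EFin_Rintegral//; last exact: (integrable_norm i1).
rewrite lee_fin (le_trans b1)// ler_wpM2l//.
Qed.

Section trigpair.
Variables c d : R -> R.
Hypothesis cc : continuous c.
Hypothesis c1 : forall x, `|c x| <= 1.
Hypothesis cd : continuous d.
Hypothesis d1 : forall x, `|d x| <= 1.
Hypothesis dD : forall t, is_derive t (1 : R) d (c t).
Variable s : R.

Lemma deriv_lip x y : `|d y - d x| <= `|y - x|.
Proof.
wlog xy : x y / x <= y.
  move=> H; have [/H//|/ltW /H] := leP x y.
  by rewrite distrC (distrC x).
rewrite -(Rintegral_derive xy cc dD).
have ic : mu.-integrable `]x, y] (EFin \o c).
  by apply: (@continuous_integrable_itv _ _ _ x y) => //; exact: subset_itv_oc_cc.
have i1 : mu.-integrable `]x, y] (EFin \o (fun=> 1 : R)).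
  apply: (@continuous_integrable_itv _ _ _ x y); last exact: subset_itv_oc_cc.
  by move=> z; exact: cvg_cst.
rewrite (le_trans (le_normr_Rintegral _ _))//.
rewrite ger0_norm ?subr_ge0//.
have c1' : continuous (fun _ : R => 1 : R) by move=> z; exact: cvg_cst.
have -> : y - x = \int[mu]_(z in `]x, y]) 1.
  by rewrite (@Rintegral_derive _ x y id)//.
apply: le_Rintegral => //; exact: (integrable_norm ic).
Qed.

Let f x := d (s * x) * phi x.

(** This estimate of a single increment yields both the absolute continuity and the bounded
    variation of f; the second term comes from d being 1-Lipschitz. *)
Let f_incr M x y : (forall z, `|phi z| <= M) ->
  `|f y - f x| <= `|phi y - phi x| + M * `|s| * `|y - x|.
Proof.
move=> pM; rewrite /f.
rewrite (_ : _ - _ = d (s * y) * (phi y - phi x) + (d (s * y) - d (s * x)) * phi x); last by ring.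
rewrite (le_trans (ler_normD _ _))// lerD// normrM.
  by rewrite ler_piMl.
rewrite mulrC -mulrA; apply: ler_pM => //.
by rewrite -normrM mulrBr; exact: deriv_lip.
Qed.

Let cf : continuous f.
Proof. by move=> x; apply: cvgM; [exact: (continuous_scale cd)|exact: AC_loc_continuous]. Qed.

Let acf a b : a <= b -> abs_cont_on a b f.
Proof.
move=> ab e e0; have [M M0 [_ pM]] := BV0_bound.
have e20 : 0 < e / 2 by rewrite divr_gt0.
have [del del0 H] := acl ab e20.
(* The summand 1 permits the division even when M or s is 0. *)
have K0 : 0 < M * `|s| + 1 by rewrite ltr_wpDl// mulr_ge0.
exists (Num.min del (e / 2 / (M * `|s| + 1))).
  by rewrite lt_min del0 divr_gt0.
move=> n u v uvb vu; rewrite lt_min => /andP[l1 l2].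
have h1 := H n u v uvb vu l1.
apply: (@le_lt_trans _ _ (\sum_(k < n) `|phi (v k) - phi (u k)| + M * `|s| * \sum_(k < n) (v k - u k))).
  rewrite mulr_sumr -big_split/=; apply: ler_sum => i _.
  have [_ [uv _]] := uvb i (ltn_ord i).
  by have := @f_incr M (u i) (v i) pM; rewrite (@ger0_norm _ (v i - u i)) ?subr_ge0.
have l0 : 0 <= \sum_(k < n) (v k - u k).
  by apply: sumr_ge0 => i _; have [_ [uv _]] := uvb i (ltn_ord i); rewrite subr_ge0.
move: l2; rewrite ltr_pdivlMr// => l2.
have : M * `|s| * \sum_(k < n) (v k - u k) < e / 2.
  by apply: le_lt_trans l2; rewrite mulrC ler_wpM2l// lerDl.
lra.
Qed.

Let bvf a b : a <= b -> bounded_variation a b f.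
Proof.
move=> ab; have [M M0 [bvM pM]] := BV0_bound.
have [[V HV] _] := bvM _ _ ab.
exists (V + M * `|s| * (b - a)) => _ [l abl <-].
have := HV (variation a b phi l); have vl : variations a b phi (variation a b phi l) by exists l.
move=> /(_ vl) => h1.
have h2 : variation a b id l = b - a by rewrite nondecreasing_variation.
rewrite -h2 (le_trans _ (lerD h1 (lexx _)))//.
rewrite !variation_pairmap mulr_sumr -big_split/=; apply: ler_sum => -[x y] _ /=.
exact: f_incr.
Qed.

Let idphi' : mu.-integrable setT (EFin \o (fun x => d (s * x) * phi^`()%classic x)).
Proof. exact: (integrable_trig cd d1 s integrable_derive1_BV0). Qed.

Let icphi a b : mu.-integrable `]a, b] (EFin \o (fun x => c (s * x) * phi x)).
Proof.
apply: (@continuous_integrable_itv _ _ _ a b); last exact: subset_itv_oc_cc.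
by move=> x; apply: cvgM; [exact: (continuous_scale cc)|exact: AC_loc_continuous].
Qed.

(** The fundamental theorem for the product f, with the product rule at almost every point. The pair
    (c, d) stands for (cos, sin) and for (sin, - cos). *)
Lemma integration_by_parts_ac a b : a < b ->
  s * \int[mu]_(x in `]a, b]) (c (s * x) * phi x) +
  \int[mu]_(x in `]a, b]) (d (s * x) * phi^`()%classic x) =
  d (s * b) * phi b - d (s * a) * phi a.
Proof.
move=> ab.
have moc : measurable (`]a, b]%classic : set R) by exact: measurable_itv.
have [_ <- _ _] := ftc_abs_cont ab cf (bvf (ltW ab)) (acf (ltW ab)).
have [M M0 [bvM _]] := BV0_bound.
have [bv _] := bvM _ _ (ltW ab).
have [_ _ _ aed] := ftc_abs_cont ab AC_loc_continuous bv (acl (ltW ab)).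
have i1 := icphi a b.
have i2 : mu.-integrable `]a, b] (EFin \o (fun x => d (s * x) * phi^`()%classic x)).
  by apply: integrableS idphi'.
have i3 : mu.-integrable `]a, b] (EFin \o (fun x => s * (c (s * x) * phi x))).
  exact: integrable_scaleR.
rewrite -RintegralZl// -RintegralD// /Rintegral; congr fine.
apply: ae_eq_integral => //.
- by apply: (measurable_int mu); exact: (integrableD _ i3 i2).
- by apply/measurable_EFinP; apply: measurable_funTS; exact: measurable_derive1.
have aeb : {ae mu, forall x, x != b}.
  exists [set b]; split => //; first exact: lebesgue_measure_set1.
  by move=> x /= /negP; rewrite negbK => /eqP.
apply: ae_mono (ae_and aeb aed) => x [xb H] /=; rewrite in_itv/= => /andP[ax xb'].
have {}H : derivable phi x 1 by apply: H => //; rewrite lt_neqAle xb.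
have dphi : is_derive x (1 : R) phi (phi^`()%classic x).
  by apply: DeriveDef => //; rewrite derive1E.
have dd : is_derive x (1 : R) (fun x => d (s * x)) (c (s * x) * s).
  exact: (@is_derive1_comp _ d (fun x => s * x) _ _ _ (dD _) (is_derive_linear s x)).
have [_ df] := is_deriveM dd dphi.
congr EFin; rewrite [RHS]derive1E.
have -> : 'D_1 f x = d (s * x) *: phi^`()%classic x + phi x *: (c (s * x) * s) by exact: df.
by rewrite /GRing.scale/=; ring.
Qed.

(* The boundary terms vanish in the limit because phi does. *)
Lemma lim_int_parts : s != 0 ->
  lim_int (fun x => c (s * x) * phi x) (- s^-1 * trigint d phi^`()%classic s).
Proof.
move=> s0 e e0.
case: bv0 => _ [phiy phiNy].
have as0 : 0 < `|s| by rewrite normr_gt0.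
(* One third for each boundary term and one for the tail of the integral of phi'; the factor |s|
   compensates the division by s. *)
have e30 : 0 < e * `|s| / 3 by rewrite divr_gt0// mulr_gt0.
have [M1 [_ H1]] : pinfty_nbhs R (fun x => `|phi x| < e * `|s| / 3).
  have /cvgrPdist_lt /(_ _ e30) := phiy.
  by apply: filterS => y; rewrite sub0r normrN.
have [M2 [_ H2]] : ninfty_nbhs R (fun x => `|phi x| < e * `|s| / 3).
  have /cvgrPdist_lt /(_ _ e30) := phiNy.
  by apply: filterS => y; rewrite sub0r normrN.
have [M3 H3] := lim_int_integrable idphi' e30.
(* The summand 1 forces a < b, as integration by parts requires. *)
exists (1 + `|M1| + `|M2| + `|M3|) => a b aM Mb ab.
have := ler_norm M1; have := ler_norm (- M2); have := ler_norm M3.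
rewrite normrN; have := normr_ge0 M1; have := normr_ge0 M2; have := normr_ge0 M3.
move=> ? ? ? ? ? ?.
have h1 : `|phi b| < e * `|s| / 3 by apply: H1; lra.
have h2 : `|phi a| < e * `|s| / 3 by apply: H2; lra.
have h3 : `|\int[mu]_(x in `]a, b]) (d (s * x) * phi^`()%classic x) -
   \int[mu]_x (d (s * x) * phi^`()%classic x)| < e * `|s| / 3.
  by apply: H3; lra.
have ab' : a < b by lra.
have := integration_by_parts_ac ab'.
rewrite /trigint; move: h3.
set X := \int[mu]_(x in _) (d _ * _); set Y := \int[mu]_x _; set Z := \int[mu]_(x in _) _.
move=> h3 E.
rewrite -(ltr_pM2r as0) -normrM mulrBl.
have -> : - s^-1 * Y * s = - Y by field.
have -> : Z * s - - Y = d (s * b) * phi b - d (s * a) * phi a - (X - Y) by rewrite -E; ring.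
rewrite (le_lt_trans (ler_normB _ _))//.
have g1 : `|d (s * b) * phi b| <= `|phi b| by rewrite normrM ler_piMl.
have g2 : `|d (s * a) * phi a| <= `|phi a| by rewrite normrM ler_piMl.
have := ler_normB (d (s * b) * phi b) (d (s * a) * phi a).
lra.
Qed.

End trigpair.

Lemma cos_continuous_phi (s : R) : continuous (fun x => cos (s * x) * phi x).
Proof.
by move=> x; apply: cvgM; [exact: (continuous_scale (@continuous_cos R))|exact: AC_loc_continuous].
Qed.

Lemma sin_continuous_phi (s : R) : continuous (fun x => sin (s * x) * phi x).
Proof.
by move=> x; apply: cvgM; [exact: (continuous_scale (@continuous_sin R))|exact: AC_loc_continuous].
Qed.

Lemma lim_int_cos (s : R) : s != 0 ->
  lim_int (fun x => cos (s * x) * phi x) (- s^-1 * trigint sin phi^`()%classic s).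
Proof.
apply: lim_int_parts; [exact: continuous_cos|exact: cos_norm1|exact: continuous_sin|exact: sin_norm1].
Qed.

Lemma lim_int_sin (s : R) : s != 0 ->
  lim_int (fun x => sin (s * x) * phi x) (s^-1 * trigint cos phi^`()%classic s).
Proof.
move=> s0.
have cN : continuous (fun x : R => - cos x).
  by move=> x; apply: cvgN; exact: continuous_cos.
have -> : s^-1 * trigint cos phi^`()%classic s =
    - s^-1 * trigint (fun x => - cos x) phi^`()%classic s.
  rewrite mulNr -mulrN; congr (_ * _).
  rewrite /trigint -[RHS]mulN1r -RintegralZl//.
    by apply: eq_Rintegral => x _; rewrite mulN1r mulNr opprK.
  apply: (integrable_trig cN); last exact: integrable_derive1_BV0.
  by move=> x; rewrite normrN cos_norm1.
apply: lim_int_parts => //; [exact: continuous_sin|exact: sin_norm1| |].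
  by move=> x; rewrite normrN cos_norm1.
move=> t; have := is_deriveN (is_derive_cos t).
by rewrite opprK.
Qed.

Lemma HKint_cos (s : R) : s != 0 ->
  HKint (fun x => cos (s * x) * phi x) = - s^-1 * trigint sin phi^`()%classic s.
Proof. by move=> s0; apply: lim_int_HK; [exact: cos_continuous_phi|exact: lim_int_cos]. Qed.

Lemma HKint_sin (s : R) : s != 0 ->
  HKint (fun x => sin (s * x) * phi x) = s^-1 * trigint cos phi^`()%classic s.
Proof. by move=> s0; apply: lim_int_HK; [exact: sin_continuous_phi|exact: lim_int_sin]. Qed.

End parts.

(** * The Plancherel inequality for conditionally convergent transforms *)

Section plancherel_lim.
Context {R : realType}.
Local Notation mu := (@lebesgue_measure R).

Lemma ae_neq0 : {ae mu, forall x : R, x != 0}.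
Proof.
exists [set 0]; split => //; first exact: lebesgue_measure_set1.
by move=> x /= /negP; rewrite negbK => /eqP.
Qed.

(** At s = 0 the integral may fail to converge, leaving A 0 a default value; measurability has to
    survive this one uncontrolled point. *)
Lemma measurable_cvg_off0 (g : nat -> R -> R) (A : R -> R) :
  (forall m, measurable_fun setT (g m)) ->
  (forall s, s != 0 -> g m s @[m --> \oo] --> A s) -> measurable_fun setT A.
Proof.
move=> mg gA.
pose h m s := g m s * \1_(~` [set 0]) s + A 0 * \1_[set 0] s.
apply: (@measurable_fun_cvg _ _ _ _ h) => [m|s _].
  apply: measurable_funD; apply: measurable_funM => //.
  by apply: measurable_indic; exact: measurableC.
rewrite /h !indicE; have [->|s0] := eqVneq s 0.
  rewrite (_ : (fun m => _) = fun=> A 0); first exact: cvg_cst.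
  apply/funext => m; rewrite memNset; last by move=> /(_ erefl).
  by rewrite mem_set// mulr0 add0r mulr1.
rewrite (_ : (fun m => _) = g ^~ s); first exact: gA.
apply/funext => m; rewrite mem_set; last by move=> /= /eqP; exact/negP.
by rewrite memNset ?mulr0 ?addr0 ?mulr1// => /= /eqP; exact/negP.
Qed.

Lemma integrable_patch (D : set R) (f : R -> R) : measurable D ->
  mu.-integrable D (EFin \o f) -> mu.-integrable setT (EFin \o (f \_ D)).
Proof.
by move=> mD fi; rewrite -restrict_EFin;
  apply: (@integrable_mkcond _ _ _ mu D (EFin \o f) mD).1.
Qed.

Lemma limn_einf_le (v : (\bar R)^nat) M : (forall n, v n <= M)%E -> (limn_einf v <= M)%E.
Proof.
move=> vM; rewrite limn_einf_lim; apply: lime_le; first exact: is_cvg_einfs.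
apply: nearW => n; apply: le_trans (vM n).
by apply: ereal_inf_lbound; exists n => /=.
Qed.

(** Used twice: for phi, to place its transform in L^2, and for u_n - phi, to obtain the
    convergence. The truncations are integrable and square integrable, and their transforms converge
    to A and B for s != 0. *)
Lemma plancherel_lim (f A B : R -> R) : measurable_fun setT f ->
  (forall a b, mu.-integrable `]a, b] (EFin \o f)) ->
  mu.-integrable setT (EFin \o (fun x => f x ^+ 2)) ->
  (forall s, s != 0 -> lim_int (fun x => cos (s * x) * f x) (A s)) ->
  (forall s, s != 0 -> lim_int (fun x => sin (s * x) * f x) (B s)) ->
  [/\ measurable_fun setT A, measurable_fun setT B &
   (\int[mu]_s (A s ^+ 2 + B s ^+ 2)%:E <= (2 * pi)%:E * \int[mu]_x (f x ^+ 2)%:E)%E].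
Proof.
move=> mf iab if2 limA limB.
pose D (m : nat) : set R := `](- m%:R), m%:R]%classic.
have mD m : measurable (D m) by exact: measurable_itv.
pose w m := f \_ (D m).
have iw m : mu.-integrable setT (EFin \o w m).
  by apply: integrable_patch => //; exact: iab.
have w2 m x : w m x ^+ 2 = ((fun x => f x ^+ 2) \_ (D m)) x.
  by rewrite /w !patchE; case: ifP => //; rewrite expr0n.
have iw2 m : mu.-integrable setT (EFin \o (fun x => w m x ^+ 2)).
  rewrite (_ : (fun x => w m x ^+ 2) = (fun x => f x ^+ 2) \_ (D m)); last exact/funext/w2.
  have iS (k : R -> R) (C : set R) : measurable C -> mu.-integrable setT (EFin \o k) ->
      mu.-integrable C (EFin \o k).
    by move=> mC; exact: integrableS.
  have i2m := iS _ _ (mD m) if2.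
  exact: (integrable_patch (f := fun x => f x ^+ 2) (mD m) i2m).
have trigE c m s : trigint c (w m) s = \int[mu]_(x in D m) (c (s * x) * f x).
  rewrite [RHS]Rintegral_mkcond; apply: eq_Rintegral => x _.
  by rewrite /w !patchE; case: ifP => // _; rewrite mulr0.
have cvgA s : s != 0 -> trigint cos (w m) s @[m --> \oo] --> A s.
  by move=> /limA/lim_int_cvg; under [in X in _ -> X]eq_fun do rewrite trigE.
have cvgB s : s != 0 -> trigint sin (w m) s @[m --> \oo] --> B s.
  by move=> /limB/lim_int_cvg; under [in X in _ -> X]eq_fun do rewrite trigE.
have mCm m : measurable_fun setT (trigint cos (w m)).
  exact: (measurable_trigint (@continuous_cos R) cos_norm1).
have mSm m : measurable_fun setT (trigint sin (w m)).
  exact: (measurable_trigint (@continuous_sin R) sin_norm1).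
have mA : measurable_fun setT A by exact: measurable_cvg_off0 mCm cvgA.
have mB : measurable_fun setT B by exact: measurable_cvg_off0 mSm cvgB.
split => //.
pose N : set R := ~` [set 0].
have mN : measurable N by exact: measurableC.
have mQ m : measurable_fun setT (fun s => trigint cos (w m) s ^+ 2 + trigint sin (w m) s ^+ 2).
  by apply: measurable_funD; exact: measurable_funX.
have mAB : measurable_fun setT (fun s => A s ^+ 2 + B s ^+ 2).
  by apply: measurable_funD; exact: measurable_funX.
(* Erasing the point 0 gives convergence at every s, so the lower limit in Fatou's lemma can be
   computed pointwise. *)
pose P m s := (trigint cos (w m) s ^+ 2 + trigint sin (w m) s ^+ 2) * \1_N s.
have mP m : measurable_fun setT (P m).
  by apply: measurable_funM; [exact: mQ|exact: measurable_indic].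
have P0 m s : 0 <= P m s by rewrite mulr_ge0// addr_ge0// sqr_ge0.
have cvgP s : P m s @[m --> \oo] --> (A s ^+ 2 + B s ^+ 2) * \1_N s.
  rewrite /P indicE; have [->|s0] := eqVneq s 0.
    rewrite memNset; last by move=> /(_ erefl).
    under eq_fun do rewrite mulr0.
    by rewrite mulr0; exact: cvg_cst.
  apply: cvgM; last exact: cvg_cst.
  have sq (v : nat -> R) (l : R) : v m @[m --> \oo] --> l -> v m ^+ 2 @[m --> \oo] --> l ^+ 2.
    move=> vl; rewrite expr2 (_ : (fun m => v m ^+ 2) = (fun m => v m * v m)).
      exact: (cvgM vl vl).
    by apply/funext => k; rewrite expr2.
  exact: cvgD (sq _ _ (cvgA _ s0)) (sq _ _ (cvgB _ s0)).
have limP s : limn_einf (fun m => (P m s)%:E) = ((A s ^+ 2 + B s ^+ 2) * \1_N s)%:E.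
  have cE : (P m s)%:E @[m --> \oo] --> ((A s ^+ 2 + B s ^+ 2) * \1_N s)%:E.
    by apply: cvg_EFin; [exact: nearW|exact: cvgP].
  rewrite is_cvg_limn_einfE; last by apply/cvg_ex; eexists; exact: cE.
  exact: (cvg_lim _ cE).
have -> : (\int[mu]_s (A s ^+ 2 + B s ^+ 2)%:E =
    \int[mu]_s limn_einf (fun m => (P m s)%:E))%E.
  under [RHS]eq_integral do rewrite limP.
  apply: ae_eq_integral => //.
  - by apply/measurable_EFinP; exact: mAB.
  - apply/measurable_EFinP; apply: measurable_funM; first exact: mAB.
    exact: measurable_indic.
  apply: ae_mono ae_neq0 => s s0 _.
  by rewrite indicE mem_set ?mulr1// => /= /eqP; exact/negP.
apply: (le_trans (fatou _ _ _ _)) => //.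
- by move=> m; apply/measurable_EFinP; exact: mP.
- by move=> m s _; rewrite lee_fin.
apply: limn_einf_le => m.
apply: (@le_trans _ _ (\int[mu]_s (trigint cos (w m) s ^+ 2 + trigint sin (w m) s ^+ 2)%:E)%E).
  apply: ge0_le_integral => //.
  - by move=> s _; rewrite lee_fin.
  - by apply/measurable_EFinP; exact: mP.
  - by apply/measurable_EFinP; exact: mQ.
  - by move=> s _; rewrite lee_fin /P ler_piMr ?addr_ge0 ?sqr_ge0.
apply: (le_trans (plancherel_trigint (iw m) (iw2 m))).
rewrite EFinM lee_wpmul2l ?lee_fin ?mulr_ge0 ?pi_ge0//.
rewrite EFin_Rintegral//; apply: ge0_le_integral => //.
- by move=> x _; rewrite lee_fin sqr_ge0.
- by apply: (measurable_int mu); exact: iw2.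
- by apply: (measurable_int mu); exact: if2.
- by move=> x _; rewrite lee_fin w2 patchE; case: ifP => // _; rewrite sqr_ge0.
Qed.

End plancherel_lim.

(** * Integrability and norms in L^p *)

Section Lp.
Context {R : realType}.
Local Notation mu := (@lebesgue_measure R).
Implicit Types (f g : R -> R).

Lemma Lp_integrable_powR (p : R) f : 0 < p -> Lp p f ->
  mu.-integrable setT (EFin \o (fun x => `|f x| `^ p)).
Proof.
move=> p0 [mf fy]; apply/integrableP; split.
  apply/measurable_EFinP; apply: (measurableT_comp (measurable_powR p)).
  exact: measurableT_comp.
have := poweR_lty p fy; rewrite powR_Lnorm ?gt_eqF//.
congr (_ < _)%E; apply: eq_integral => x _ /=.
by rewrite [in RHS]ger0_norm// powR_ge0.
Qed.

Lemma Lp1_integrable f : Lp 1 f -> mu.-integrable setT (EFin \o f).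
Proof.
move=> [mf fy]; apply/integrableP; split; first exact/measurable_EFinP.
by rewrite -Lnorm1.
Qed.

Lemma Lp2_integrable_sqr f : Lp 2 f -> mu.-integrable setT (EFin \o (fun x => f x ^+ 2)).
Proof.
move=> /(Lp_integrable_powR (ltr0n R 2)).
rewrite (_ : (fun x => `|f x| `^ 2) = fun x => f x ^+ 2)//.
by apply/funext => x /=; rewrite powR_mulrn// real_normK ?num_real.
Qed.

Lemma Lnorm2E f : (Lnorm mu 2%:E (EFin \o f) =
  (\int[mu]_x (f x ^+ 2)%:E) `^ (2^-1))%E.
Proof.
rewrite -[LHS]poweRe1 ?Lnorm_ge0// -[X in (_ `^ X)%E](@mulfV _ (2 : R)) ?pnatr_eq0//.
rewrite poweRrM powR_Lnorm ?pnatr_eq0//; congr (_ `^ _)%E.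
apply: eq_integral => x _ /=.
by rewrite powR_mulrn// real_normK ?num_real.
Qed.

Lemma le_Lnorm2 f g :
  (\int[mu]_x (f x ^+ 2)%:E <= \int[mu]_x (g x ^+ 2)%:E)%E ->
  (Lnorm mu 2%:E (EFin \o f) <= Lnorm mu 2%:E (EFin \o g))%E.
Proof.
move=> fg; rewrite !Lnorm2E; apply: gt0_ler_poweR => //.
- by rewrite in_itv/= leey integral_ge0// => x _; rewrite lee_fin sqr_ge0.
- by rewrite in_itv/= leey integral_ge0// => x _; rewrite lee_fin sqr_ge0.
Qed.

Lemma Lp2_sqr f : measurable_fun setT f ->
  mu.-integrable setT (EFin \o (fun x => f x ^+ 2)) -> Lp 2 f.
Proof.
move=> mf /integrableP[_ fy]; split => //; rewrite Lnorm2E poweR_lty//.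
apply: le_lt_trans fy; apply: ge0_le_integral => //.
- by move=> x _; rewrite lee_fin sqr_ge0.
- by apply/measurable_EFinP; exact: measurable_funX.
- apply: measurableT_comp => //; apply/measurable_EFinP; exact: measurable_funX.
- by move=> x _; rewrite lee_fin ger0_norm ?sqr_ge0.
Qed.

(** (f - g)^2 is dominated by 2 f^2 + 2 g^2, the excess being (f + g)^2. *)
Lemma integrable_sqrB f g : measurable_fun setT f -> measurable_fun setT g ->
  mu.-integrable setT (EFin \o (fun x => f x ^+ 2)) ->
  mu.-integrable setT (EFin \o (fun x => g x ^+ 2)) ->
  mu.-integrable setT (EFin \o (fun x => (f x - g x) ^+ 2)).
Proof.
move=> mf mg f2 g2.
have fg2 := integrableD measurableT (integrable_scaleR 2 measurableT f2)
  (integrable_scaleR 2 measurableT g2).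
apply: (@le_integrable _ _ _ mu setT measurableT) fg2 => //.
  by apply/measurable_EFinP; apply: measurable_funX; exact: measurable_funB.
move=> x _; rewrite /= lee_fin (ger0_norm (sqr_ge0 (f x - g x))).
have d0 (y : R) : 0 <= 2 * y ^+ 2 by apply: mulr_ge0 => //; exact: sqr_ge0.
rewrite [leRHS]ger0_norm ?addr_ge0// -subr_ge0 (_ : _ - _ = (f x + g x) ^+ 2) ?sqr_ge0//.
by ring.
Qed.

(** |f|^2 = |f|^(2 - p) |f|^p <= M^(2 - p) |f|^p, where p <= 2 keeps the first exponent
    nonnegative. *)
Lemma Lp_bounded_Lp2 (p M : R) f : 1 <= p <= 2 -> (forall x, `|f x| <= M) ->
  Lp p f -> Lp 2 f.
Proof.
move=> /andP[p1 p2] fM fp.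
have p0 : 0 < p by exact: lt_le_trans p1.
have [mf _] := fp; apply: Lp2_sqr => //.
have M0 : 0 <= M by apply: le_trans (fM 0).
have i1 := integrable_scaleR (M `^ (2 - p)) measurableT (Lp_integrable_powR p0 fp).
apply: (@le_integrable _ _ _ mu setT measurableT) i1 => //.
  by apply/measurable_EFinP; exact: measurable_funX.
move=> x _ /=; rewrite lee_fin normrX -powR_mulrn// [leRHS]ger0_norm ?mulr_ge0 ?powR_ge0//.
rewrite [X in _ `^ X](_ : _ = (2 - p) + p); last by rewrite subrK.
rewrite powRD; last by rewrite subrK pnatr_eq0 implyFb.
rewrite ler_wpM2r ?powR_ge0//; apply: ge0_ler_powR; rewrite ?nnegrE ?subr_ge0//.
Qed.

Lemma Lp_cst0 (p : R) : 0 < p -> Lp p (fun _ : R => 0 : R).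
Proof.
move=> p0; split; first exact: measurable_cst.
have := @Lnorm0 _ _ _ mu p%:E; rewrite /leb => -> //; last first.
by rewrite eqe gt_eqF.
Qed.

End Lp.

(** * Normalisation and modulus of the complex transform *)

Section transform.
Context {R : realType}.
Local Notation mu := (@lebesgue_measure R).
Implicit Types (f g : R -> R) (z : R[i]).

Lemma cF_gt0 : 0 < cF R.
Proof. by rewrite invr_gt0 sqrtr_gt0 mulr_gt0// pi_gt0. Qed.

Lemma cF_sqr : cF R ^+ 2 = (2 * pi)^-1.
Proof. by rewrite exprVn sqr_sqrtr// mulr_ge0// pi_ge0. Qed.

Lemma cnorm_ge0 z : 0 <= cnorm z.
Proof. exact: sqrtr_ge0. Qed.

Lemma cnorm_le z : cnorm z <= `|complex.Re z| + `|complex.Im z|.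
Proof.
rewrite -(@ler_pXn2r _ 2%N)// ?nnegrE ?cnorm_ge0 ?addr_ge0//.
rewrite sqr_sqrtr ?addr_ge0 ?sqr_ge0// sqrrD !real_normK ?num_real//.
by rewrite -addrA lerD2l lerDr mulrn_wge0// mulr_ge0.
Qed.

Lemma cnorm_sqr z : cnorm z ^+ 2 = complex.Re z ^+ 2 + complex.Im z ^+ 2.
Proof. by rewrite sqr_sqrtr// addr_ge0 ?sqr_ge0. Qed.

(** Bounding C and S separately would lose the constant 1 of the final estimate. Instead r^2 = C^2 +
    S^2 is written as one integral of f against a kernel of size at most r, and r is cancelled. *)
Lemma trigint_modulus_le f s : mu.-integrable setT (EFin \o f) ->
  Num.sqrt (trigint cos f s ^+ 2 + trigint sin f s ^+ 2) <= \int[mu]_x `|f x|.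
Proof.
move=> fi; set C := trigint cos f s; set S := trigint sin f s.
set r := Num.sqrt _.
have CS0 : 0 <= C ^+ 2 + S ^+ 2 by rewrite addr_ge0 ?sqr_ge0.
have r2 : r ^+ 2 = C ^+ 2 + S ^+ 2 by rewrite sqr_sqrtr.
have [r0|r0] := eqVneq r 0.
  by rewrite r0; apply: Rintegral_ge0 => x _; exact: normr_ge0.
have rp : 0 < r by rewrite lt_def r0 sqrtr_ge0.
have ic := integrable_trig (@continuous_cos R) cos_norm1 s fi.
have is_ := integrable_trig (@continuous_sin R) sin_norm1 s fi.
(* The complex exponential rotated by the phase of the transform, up to the factor r; the bound |k|
   <= r is Lagrange's identity. *)
pose k x := C * cos (s * x) + S * sin (s * x).
have kr x : `|k x| <= r.
  rewrite -(@ler_pXn2r _ 2%N)// ?nnegrE ?normr_ge0 ?sqrtr_ge0// real_normK ?num_real// r2.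
  have := cos2Dsin2 (s * x); rewrite /k => cs.
  rewrite -[leRHS]mulr1 -cs -subr_ge0.
  rewrite (_ : _ - _ = (C * sin (s * x) - S * cos (s * x)) ^+ 2) ?sqr_ge0//.
  by ring.
have mk : measurable_fun setT k.
  by apply: measurable_funD; apply: measurable_funM => //;
    apply: continuous_measurable_fun; apply: continuous_scale;
    [exact: continuous_cos|exact: continuous_sin].
have e : r ^+ 2 = \int[mu]_x (k x * f x).
  rewrite r2 !expr2 {1}/C {1}/S /trigint.
  rewrite -!RintegralZl// -RintegralD//; [|exact: integrable_scaleR..].
  by apply: eq_Rintegral => x _; rewrite /k mulrDl !mulrA.
have := norm_Rintegral_bdM mk kr fi.
by rewrite -e normrX ger0_norm ?sqrtr_ge0// expr2 ler_pM2l.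
Qed.

Lemma F1E f s : F1 f s = Complex (cF R * trigint cos f s) (- (cF R * trigint sin f s)).
Proof. by []. Qed.

End transform.

(** * The four properties of the Henstock-Kurzweil transform *)

Section FHK_BV0.
Context {R : realType}.
Local Notation mu := (@lebesgue_measure R).
Variable phi : R -> R.
Hypothesis bv0 : BV0 phi.
Hypothesis acl : AC_loc phi.
Local Notation phi' := (phi^`()%classic).
Let idphi : mu.-integrable setT (EFin \o phi').
Proof. exact: integrable_derive1_BV0. Qed.

Lemma FHK_trigint s : s != 0 -> FHK phi s =
  Complex (cF R * (- s^-1 * trigint sin phi' s)) (- (cF R * (s^-1 * trigint cos phi' s))).
Proof. by move=> s0; rewrite /FHK (HKint_cos bv0 acl s0) (HKint_sin bv0 acl s0). Qed.

Lemma FHK_F1_derive s : s != 0 ->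
  FHK phi s = - (Complex 0 1 / s%:C) * F1 phi' s.
Proof.
move=> s0; have -> : Complex 0 1 / s%:C = Complex 0 s^-1.
  apply: (mulIf (x := s%:C)); first by rewrite eq_complex/= negb_and s0.
  rewrite divfK; last by rewrite eq_complex/= negb_and s0.
  by apply/eqP; rewrite eq_complex /= !mul0r !mulr0 subr0 add0r mulVf ?eqxx.
rewrite FHK_trigint// F1E; apply/eqP; rewrite eq_complex /=.
by apply/andP; split; apply/eqP; ring.
Qed.

Lemma cnorm_FHK_le s : s != 0 ->
  cnorm (FHK phi s) <= cF R * `|s|^-1 * normp 1 phi'.
Proof.
move=> s0; have -> : normp 1 phi' = \int[mu]_x `|phi' x| by rewrite /normp Lnorm1.
rewrite FHK_trigint// /cnorm /=.
set C := trigint cos _ _; set S := trigint sin _ _.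
rewrite (_ : _ + _ = (cF R * `|s|^-1) ^+ 2 * (C ^+ 2 + S ^+ 2)); last first.
  have -> : (cF R * `|s|^-1) ^+ 2 = (cF R * s^-1) ^+ 2.
    by rewrite !exprMn !exprVn real_normK ?num_real.
  by ring.
have c0 : 0 <= cF R * `|s|^-1 by rewrite mulr_ge0 ?invr_ge0// ltW// cF_gt0.
rewrite sqrtrM ?sqr_ge0// sqrtr_sqr ger0_norm// ler_wpM2l//.
exact: trigint_modulus_le.
Qed.

(** Away from 0 the transform is 1 / s times a continuous transform of phi', and its decay is the
    explicit K / |t|. The latter is stated for an arbitrary filter along which |t| grows, to serve
    both ends of the line. *)
Lemma FHK_Cinf0 : Cinf0 (FHK phi).
Proof.
have decay (F : set_system R) : Filter F -> (forall M : R, \forall t \near F, M < `|t|) ->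
    cnorm (FHK phi t) @[t --> F] --> 0.
  move=> FF Fy; apply/cvgrPdist_lt => e e0.
  set K := cF R * normp 1 phi'.
  have K0 : 0 <= K.
    by rewrite mulr_ge0 ?(ltW cF_gt0)// fine_ge0// Lnorm_ge0.
  apply: filterS (Fy (K / e)) => t Kt.
  have t0 : 0 < `|t| by apply: le_lt_trans Kt; rewrite divr_ge0// ltW.
  rewrite sub0r normrN ger0_norm ?cnorm_ge0//.
  rewrite (le_lt_trans (cnorm_FHK_le _)) -?normr_gt0//.
  by rewrite mulrAC ltr_pdivrMr// [ltRHS]mulrC -ltr_pdivrMr.
split; [|split].
- move=> s s0.
  pose U t := cF R * (- t^-1 * trigint sin phi' t).
  pose V t := cF R * (t^-1 * trigint cos phi' t).
  have cinv : t^-1 @[t --> s] --> s^-1 by apply: cvgV => //; exact: cvg_id.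
  have cU : U t @[t --> s] --> U s.
    apply: cvgM; first exact: cvg_cst.
    apply: cvgM; first exact: cvgN cinv.
    exact: (continuous_trigint (@continuous_sin R) sin_norm1 idphi).
  have cV : V t @[t --> s] --> V s.
    apply: cvgM; first exact: cvg_cst.
    apply: cvgM; first exact: cinv.
    exact: (continuous_trigint (@continuous_cos R) cos_norm1 idphi).
  have cUV : `|U t - U s| + `|V t - V s| @[t --> s] --> (0 : R).
    have dist0 (h : R -> R) : h t @[t --> s] --> h s -> `|h t - h s| @[t --> s] --> (0 : R).
      move=> hs; rewrite -(@normr0 _ R) -(subrr (h s)).
      by apply: cvg_norm; apply: cvgB => //; exact: cvg_cst.
    by rewrite -[X in _ --> X]addr0; exact: cvgD (dist0 _ cU) (dist0 _ cV).
  apply: (squeeze_cvgr _ (cvg_cst (0 : R)) cUV).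
  have : \forall t \near s, t != 0 by exact: open_neq.
  apply: filterS => t t0; rewrite cnorm_ge0/= (le_trans (cnorm_le _))//.
  rewrite !FHK_trigint// /= lerD//.
  by rewrite -/(U t) -/(V t) -/(V s) opprK addrC distrC.
- apply: decay => M; near=> t.
  apply: lt_le_trans (ler_norm t); near: t.
  by apply: nbhs_pinfty_gt; exact: num_real.
- apply: decay => M; near=> t.
  rewrite -normrN; apply: lt_le_trans (ler_norm (- t)); rewrite ltrNr; near: t.
  by apply: nbhs_ninfty_lt; exact: num_real.
Unshelve. all: by end_near.
Qed.

Lemma FHK_F1 s : mu.-integrable setT (EFin \o phi) -> FHK phi s = F1 phi s.
Proof.
move=> iphi; rewrite F1E /FHK; congr Complex; [congr (_ * _)|congr (- (_ * _))].
  apply: lim_int_HK; first exact: cos_continuous_phi.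
  apply: lim_int_integrable.
  exact: (integrable_trig (@continuous_cos R) cos_norm1).
apply: lim_int_HK; first exact: sin_continuous_phi.
apply: lim_int_integrable.
exact: (integrable_trig (@continuous_sin R) sin_norm1).
Qed.

Let A s := HKint (fun x => cos (s * x) * phi x).
Let B s := HKint (fun x => sin (s * x) * phi x).

Let limA s : s != 0 -> lim_int (fun x => cos (s * x) * phi x) (A s).
Proof. by move=> s0; rewrite /A (HKint_cos bv0 acl s0); exact: lim_int_cos. Qed.

Let limB s : s != 0 -> lim_int (fun x => sin (s * x) * phi x) (B s).
Proof. by move=> s0; rewrite /B (HKint_sin bv0 acl s0); exact: lim_int_sin. Qed.

Let ab_phi a b : mu.-integrable `]a, b] (EFin \o phi).
Proof. 
apply: (@continuous_integrable_itv _ _ _ a b); first exact: (AC_loc_continuous acl).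
exact: subset_itv_oc_cc.
 Qed.

Let iS (f : R -> R) (D : set R) : measurable D -> mu.-integrable setT (EFin \o f) ->
  mu.-integrable D (EFin \o f).
Proof. by move=> mD; exact: integrableS. Qed.

Let iB (f g : R -> R) (D : set R) : measurable D -> mu.-integrable D (EFin \o f) ->
  mu.-integrable D (EFin \o g) -> mu.-integrable D (EFin \o (fun x => f x - g x)).
Proof. by move=> mD fi gi; have := @integrableB _ _ _ mu D mD _ _ fi gi. Qed.

Let plancherel_Lnorm (C S f : R -> R) (z : R -> R[i]) :
  (forall s, z s = Complex (cF R * C s) (- (cF R * S s))) ->
  measurable_fun setT C -> measurable_fun setT S ->
  (\int[mu]_s (C s ^+ 2 + S s ^+ 2)%:E <= (2 * pi)%:E * \int[mu]_x (f x ^+ 2)%:E)%E ->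
  (Lnorm mu 2%:E (EFin \o (fun s => cnorm (z s))) <= Lnorm mu 2%:E (EFin \o f))%E.
Proof.
move=> zE mC mS H; apply: le_Lnorm2.
under eq_integral => s _.
  rewrite cnorm_sqr zE /= sqrrN !exprMn -mulrDr cF_sqr EFinM.
  over.
have pi2 : 0 < 2 * pi :> R by rewrite mulr_gt0// pi_gt0.
rewrite ge0_integralZl//.
- rewrite lee_pdivrMl//.
- apply/measurable_EFinP; apply: measurable_funD; exact: measurable_funX.
- by move=> s _; rewrite lee_fin addr_ge0 ?sqr_ge0.
- by rewrite lee_fin invr_ge0 ltW.
Qed.

(** By linearity, F_1(u_n) minus the transform of phi is, for s != 0, the conditional transform of
    u_n - phi; its L^2 norm is squeezed between 0 and the L^2 norm of u_n - phi. *)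
Lemma FHK_IsF2 : Lp 2 phi -> IsF2 phi (FHK phi).
Proof.
move=> phi2; have [mphi phi2y] := phi2; have iphi2 := Lp2_integrable_sqr phi2.
have [mA mB AB] := plancherel_lim mphi ab_phi iphi2 limA limB.
split; [|split; [|split]].
- by apply: measurable_funM => //; exact: mA.
- by apply: measurableT_comp => //; apply: measurable_funM => //; exact: mB.
- by apply: le_lt_trans phi2y; apply: plancherel_Lnorm mA mB AB.
move=> u uL; apply: squeeze_cvge; [|exact: cvg_cst].
apply: nearW => n; rewrite Lnorm_ge0/=.
have [u1 u2] := uL n; have iu := Lp1_integrable u1; have [mu_ _] := u1.
have ic s := integrable_trig (@continuous_cos R) cos_norm1 s iu.
have is_ s := integrable_trig (@continuous_sin R) sin_norm1 s iu.
pose C s := trigint cos (u n) s - A s.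
pose S s := trigint sin (u n) s - B s.
have dab a b : mu.-integrable `]a, b] (EFin \o (fun x => u n x - phi x)).
  have i1 : mu.-integrable `]a, b] (EFin \o u n) by apply: iS => //; exact: measurable_itv.
  by apply: iB i1 (ab_phi a b); exact: measurable_itv.
have md : measurable_fun setT (fun x => u n x - phi x) by apply: measurable_funB.
have d2 : mu.-integrable setT (EFin \o (fun x => (u n x - phi x) ^+ 2)).
  exact: integrable_sqrB mu_ mphi (Lp2_integrable_sqr u2) iphi2.
have limC s : s != 0 -> lim_int (fun x => cos (s * x) * (u n x - phi x)) (C s).
  move=> s0; under eq_fun do rewrite mulrBr.
  apply: lim_intB; [exact: lim_int_integrable|exact: limA| |].
  - move=> a b; apply: iS => //; exact: measurable_itv.
  - move=> a b; apply: (@continuous_integrable_itv _ _ _ a b); first exact: cos_continuous_phi.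
    exact: subset_itv_oc_cc.
have limS s : s != 0 -> lim_int (fun x => sin (s * x) * (u n x - phi x)) (S s).
  move=> s0; under eq_fun do rewrite mulrBr.
  apply: lim_intB; [exact: lim_int_integrable|exact: limB| |].
  - move=> a b; apply: iS => //; exact: measurable_itv.
  - move=> a b; apply: (@continuous_integrable_itv _ _ _ a b); first exact: sin_continuous_phi.
    exact: subset_itv_oc_cc.
have [mC mS CS] := plancherel_lim md dab d2 limC limS.
apply: plancherel_Lnorm mC mS CS => s.
rewrite F1E /FHK -/(A s) -/(B s); apply/eqP; rewrite eq_complex /= /C /S.
by apply/andP; split; apply/eqP; ring.
Qed.

Lemma FHK_IsFp p : 1 <= p <= 2 -> Lp p phi -> IsFp p phi (FHK phi).
Proof.
move=> p12 phip; have [M _ [_ phiM]] := BV0_bound bv0.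
have phi2 := Lp_bounded_Lp2 p12 phiM phip.
have p0 : 0 < p by case/andP: p12 => + _; exact: lt_le_trans.
rewrite /IsFp; case: eqP => [p1|_].
  rewrite p1 in phip; apply: aeW => s; exact: FHK_F1 (Lp1_integrable phip).
case: ifP => _; last exact: FHK_IsF2.
exists (fun=> 0), phi, (FHK phi); split.
- by split; exact: Lp_cst0.
- by split.
- by move=> x; rewrite add0r.
- exact: FHK_IsF2.
apply: aeW => s; rewrite F1E.
have t0 c : trigint c (fun _ : R => 0) s = 0.
  rewrite /trigint (_ : (fun x => _) = cst 0) ?Rintegral_cst ?mul0r//.
  by apply/funext => x; rewrite mulr0.
by rewrite !t0 !mulr0 oppr0 (_ : Complex 0 0 = 0)// add0r.
Qed.

End FHK_BV0.

Unset Implicit Arguments.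

Theorem mainTheorem2 (R : realType) (p : R) (phi : R -> R) :
  1 <= p <= 2 -> Lp p phi -> BV0 phi -> AC_loc phi ->
  [/\ Cinf0 (FHK phi),
      IsFp p phi (FHK phi),
      (@leb R).-integrable setT (EFin \o (derive1 phi)) /\
        (forall s : R, s != 0 ->
           FHK phi s = - (Complex 0 1 / s%:C) * F1 (derive1 phi) s) &
      forall s : R, s != 0 ->
        cnorm (FHK phi s) <= cF R * `|s|^-1 * normp 1 (derive1 phi)].
Proof.
move=> p12 phip bv0 acl; split.
- exact: FHK_Cinf0.
- exact: FHK_IsFp.
- split; first exact: integrable_derive1_BV0.
  exact: FHK_F1_derive.
- exact: cnorm_FHK_le.
Qed.
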